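(* Let $\lambda>0$ and suppose that $\max_{u\in S\cup\{T\}}\mathbb E[P_u]<\infty$. Then the backward equation $$V^\lambda_t=P_T-(M^\lambda_T-M^\lambda_t)+\sum_{t\le t_i<T}\lambda\,\Phi\Big(\frac{P_{t_i}-V^\lambda_{t_i+}}{\lambda}\Big),\qquad t\in[0,T],$$ admits a unique solution $(V^\lambda,M^\lambda)\in\mathcal D\times\mathcal M_{u.i.}$.
   Context: Setting. $(\Omega,\mathcal F,\mathbb P,\mathbb F)$ is a filtered probability space whose filtration $\mathbb F=(\mathcal F_t)_{t\ge0}$ satisfies the usual conditions; martingales are càdlàg. $T>0$, $S=\{t_0,t_1,\dots,t_N\}$ with $0=t_0<t_1<\dots<t_N<T$, and $t_{N+1}:=T$. $P$ is a non-negative $\mathbb F$-adapted process. Processes are optional semimartingales, which have finite left and right limits (but need not be càdlàg); $X_{t+}$ denotes the right limit of $X$ at $t$. $\mathcal D$ is the set of (optional, possibly non-càdlàg) semimartingales of class (D), i.e. $\{X_\tau:\tau \text{ finite stopping time}\}$ is uniformly integrable. $\mathcal M_{u.i.}$ is the set of uniformly integrable $\mathbb F$-martingales, here normalised to start at $0$. Uniqueness is up to indistinguishability. For $x\ne0$, $\Psi(x)=\frac1x\ln\big(\frac{e^x-1}{x}\big)$, $\Psi(0)=\frac12$, and $\Phi(x)=x\Psi(x)$ (so $\Phi(0)=0$). *)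

(* Defs.v *)
From HB Require Import structures.
From mathcomp Require Import all_boot all_order all_algebra.
From mathcomp Require Import all_classical all_reals all_analysis.

Set Implicit Arguments.
Unset Strict Implicit.
Unset Printing Implicit Defensive.

Import Order.TTheory GRing.Theory Num.Theory.
Import numFieldNormedType.Exports.

Local Open Scope classical_set_scope.
Local Open Scope ring_scope.

(* The time set is [0, +oo[: a process is a function [R -> Omega -> R] (time
   first), and a filtration a function [R -> set (set Omega)], of which only
   the values at times [t >= 0] are ever constrained or used. *)

Section StochasticProcesses.
Context {R : realType} {d : measure_display} {Omega : measurableType d}.
Variable Pr : probability Omega R.
Variable F : R -> set (set Omega).

Definition filtration :=
  [/\ (forall t, 0 <= t -> sigma_algebra setT (F t)),
      (forall t, 0 <= t -> F t `<=` measurable) &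
      (forall s t, 0 <= s -> s <= t -> F s `<=` F t)].

(* Since [F 0 `<=` measurable], the first clause also makes the underlying
   probability space complete. *)
Definition usual_conditions :=
  (forall A, Pr.-negligible A -> F 0 A) /\
  (forall t, 0 <= t -> \bigcap_(s in [set s | t < s]) F s `<=` F t).

Definition measurable_wrt (G : set (set Omega)) (X : Omega -> R) :=
  forall B : set R, measurable B -> G (X @^-1` B).

Definition adapted (X : R -> Omega -> R) :=
  forall t, 0 <= t -> measurable_wrt (F t) (X t).

(* Stopping times may take the value +oo. *)
Definition stopping_time (tau : Omega -> \bar R) :=
  (forall w, (0 <= tau w)%E) /\
  (forall t, 0 <= t -> F t [set w | (tau w <= t%:E)%E]).

Definition cadlag (X : R -> Omega -> R) := forall w,
  (forall t, 0 <= t -> X s w @[s --> t^'+] --> X t w) /\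
  (forall t, 0 < t -> cvg (X s w @[s --> t^'-])).

(* X_{t+}; only meaningful when the right limit exists, as it does for every
   optional semimartingale. *)
Definition right_limit (X : R -> Omega -> R) (t : R) (w : Omega) : R :=
  lim (X s w @[s --> t^'+]).

Definition indistinguishable_on (D : set R) (X Y : R -> Omega -> R) :=
  \forall w \ae Pr, forall t, D t -> X t w = Y t w.

Definition uniformly_integrable (H : set (Omega -> R)) :=
  (forall X, H X -> measurable_fun setT X) /\
  (forall eps : R, 0 < eps -> exists c : R, forall X, H X ->
    (\int[Pr]_(w in [set w | (c < `|X w|)%R]) (`|X w|)%:E <= eps%:E)%E).

(* Y is a version of E[X | G]. *)
Definition is_cond_expectation (G : set (set Omega)) (X Y : Omega -> R) :=
  [/\ measurable_wrt G Y,
      Pr.-integrable setT (EFin \o Y) &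
      forall A, G A ->
        (\int[Pr]_(w in A) (Y w)%:E = \int[Pr]_(w in A) (X w)%:E)%E].

Definition martingale (M : R -> Omega -> R) :=
  [/\ adapted M, cadlag M,
      (forall t, 0 <= t -> Pr.-integrable setT (EFin \o M t)) &
      (forall s t, 0 <= s -> s <= t -> is_cond_expectation (F s) (M t) (M s))].

(* The class M_{u.i.}, with its normalisation M_0 = 0. *)
Definition ui_martingale (M : R -> Omega -> R) :=
  [/\ martingale M,
      uniformly_integrable [set M t | t in [set t | 0 <= t]] &
      (forall w, M 0 w = 0)].

Definition stopped (X : R -> Omega -> R) (tau : Omega -> \bar R)
    (t : R) (w : Omega) : R :=
  X (fine (mine t%:E (tau w))) w.

(* Local martingales starting at 0. *)
Definition local_martingale (M : R -> Omega -> R) :=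
  [/\ adapted M, cadlag M, (forall w, M 0 w = 0) &
      exists tau : nat -> Omega -> \bar R,
        [/\ (forall n, stopping_time (tau n)),
            (forall w, {homo (fun n => tau n w) : m n / (m <= n)%N >->
                                                        (m <= n)%E}),
            (\forall w \ae Pr, tau n w @[n --> \oo] --> +oo%E) &
            (forall n, martingale (stopped M (tau n)))]].

(* The optional sigma-algebra on [0, +oo[ * Omega. *)
Definition optional_sigma_algebra : set (set (R * Omega)) :=
  let D := [set z : R * Omega | 0 <= z.1] in
  <<s D, [set E | exists X, [/\ adapted X, cadlag X &
           exists2 B : set R, measurable B &
             E = D `&` [set z | B (X z.1 z.2)]]] >>.

Definition optional (X : R -> Omega -> R) :=
  forall B : set R, measurable B ->
    optional_sigma_algebra [set z | 0 <= z.1 /\ B (X z.1 z.2)].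

Definition finite_variation (A : R -> Omega -> R) :=
  forall w t, 0 <= t -> bounded_variation 0 t (fun s => A s w).

(* X = X_0 + M + A. The finite variation part need be neither left- nor
   right-continuous, so X has finite one-sided limits but need not be cadlag.
   Under the usual conditions optional local martingales are cadlag. *)
Definition optional_semimartingale (X : R -> Omega -> R) :=
  optional X /\
  exists M A : R -> Omega -> R,
    [/\ local_martingale M, optional A, finite_variation A,
        (forall w, A 0 w = 0) &
        (forall t w, 0 <= t -> X t w = X 0 w + M t w + A t w)].

Definition class_D (X : R -> Omega -> R) :=
  uniformly_integrable
    [set (fun w => X (tau w) w) | tau in
       [set tau : Omega -> R | stopping_time (EFin \o tau)]].

(* The set of solution processes: semimartingales of class (D). *)
Definition semimartingale_D (X : R -> Omega -> R) :=
  optional_semimartingale X /\ class_D X.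

End StochasticProcesses.

Definition Psi {R : realType} (x : R) : R :=
  if x == 0 then 2^-1 else x^-1 * ln ((expR x - 1) / x).

Definition Phi {R : realType} (x : R) : R := x * Psi x.

(* [t] lists S = {t_0 < ... < t_N} and [Pay] is the process called P in the
   equation. *)
Definition solves_backward_equation {R : realType} {d : measure_display}
    {Omega : measurableType d} (Pr : probability Omega R)
    (T : R) (N : nat) (t : 'I_N.+1 -> R) (Pay : R -> Omega -> R) (lambda : R)
    (V M : R -> Omega -> R) :=
  \forall w \ae Pr, forall s, 0 <= s <= T ->
    V s w = Pay T w - (M T w - M s w)
      + \sum_(i < N.+1 | s <= t i < T)
          lambda * Phi ((Pay (t i) w - right_limit V (t i) w) / lambda).

(* Main.v *)
(* On (t_i, t_{i+1}] the equation says that V is the martingale closed by the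
   payoff still to come, so it is solved backwards in i: with Y_i = V_{t_i+} the
   conditional expectation given F_{t_i} of
   P_T + sum_{j > i} lambda Phi ((P_{t_j} - Y_j) / lambda),
   take a cadlag version Z of t |-> E[P_T + sum_j lambda Phi (...) | F_t] and put
   M = Z - Z_0, V_t = Z_t - sum_{t_j < t} lambda Phi (...).  As |Phi x| <= |x|,
   everything is integrable.  The cadlag version comes from Doob's upcrossing
   inequality on dyadic grids.  Class (D) comes from the bound
   E (Z_tau - m)^+ <= E (xi - m)^+ for Z >= 0 closed by xi: by Jensen for
   dyadic-valued tau, by Fatou in general.

   For uniqueness, the difference of two solutions is, as long as the later values
   at t_j+ agree, an F_s-measurable increment between s and T of a martingale,
   hence zero; letting s decrease to t_i gives agreement at t_i+. *)
Require Import Defs.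
From HB Require Import structures.
From mathcomp Require Import all_boot all_order all_algebra.
From mathcomp Require Import all_classical all_reals all_analysis.
From mathcomp Require Import measurable_realfun.
From mathcomp Require Import ring lra.

Set Implicit Arguments.
Unset Strict Implicit.
Unset Printing Implicit Defensive.

Import Order.TTheory GRing.Theory Num.Theory.
Import numFieldNormedType.Exports.

Local Open Scope classical_set_scope.
Local Open Scope ring_scope.

(** * Conditional expectation *)

(** Control of closed families goes through the excess E(X - m)^+. A bound by the excess of [xi]
    survives sampling and almost sure limits, needs no conditional expectation at a stopping time,
    and, being small for large [m], yields uniform integrability. Fatou, the upcrossing bound and
    the excesses all require a sign, so [xi] is split into [xi^\+] and [xi^\-], each with its own
    cadlag version. The martingale property is used in integrated form: on each event of F_t the
    integrals of Z_t and [xi] agree, so every time is compared with the one variable [xi].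

    The obstacle is that conditional expectations are chosen time by time, each up to a null set.
    Path properties are therefore read on the countable set of dyadic times. Completeness then
    allows the bad paths to be set to 0 without losing adaptedness, and right-continuity of the
    filtration makes a limit from the right adapted.

    [V] is not cadlag: the gain of date t_j still counts at t_j and is lost just after. This is why
    left-continuous step processes appear, whose optionality has to be proved. *)

Section ConditionalExpectation.
Context {R : realType} {d : measure_display} {Omega : measurableType d}.
Variable Pr : probability Omega R.
Implicit Types (G : set (set Omega)) (X Y : Omega -> R).

Lemma measurable_wrtP G X : sigma_algebra setT G ->
  measurable_wrt G X <-> measurable_fun setT (X : g_sigma_algebraType G -> R).
Proof.
move=> sG; split => [mX _ B mB|mX B mB].
  by rewrite setTI; apply: sub_sigma_algebra; exact: mX.
by have := mX measurableT B mB; rewrite setTI measurable_g_measurableTypeE.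
Qed.

Lemma measurable_wrt_sub G G' X :
  G `<=` G' -> measurable_wrt G X -> measurable_wrt G' X.
Proof. by move=> GG' mX B mB; apply: GG'; exact: mX. Qed.

Lemma measurable_wrt_measurable G X : G `<=` measurable ->
  measurable_wrt G X -> measurable_fun setT X.
Proof. by move=> Gm mX _ B mB; rewrite setTI; apply: Gm; exact: mX. Qed.

Lemma measurable_wrt_gt G X (a : R) : measurable_wrt G X -> G [set w | a < X w].
Proof.
move=> mX; rewrite (_ : mkset _ = X @^-1` `]a, +oo[).
  by apply: mX; exact: measurable_itv.
by apply/seteqP; split => w /=; rewrite in_itv/= andbT.
Qed.

Lemma measurable_wrt_ge G X (a : R) : measurable_wrt G X -> G [set w | a <= X w].
Proof.
move=> mX; rewrite (_ : mkset _ = X @^-1` `[a, +oo[).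
  by apply: mX; exact: measurable_itv.
by apply/seteqP; split => w /=; rewrite in_itv/= andbT.
Qed.

Lemma measurable_wrt_lt G X (a : R) : measurable_wrt G X -> G [set w | X w < a].
Proof.
move=> mX; rewrite (_ : mkset _ = X @^-1` `]-oo, a[).
  by apply: mX; exact: measurable_itv.
by apply/seteqP; split => w /=; rewrite in_itv/=.
Qed.

(** Testing on the event [X < 0], which lies in [G], forces the integral of [|X|] there to
    vanish. *)
Lemma ge0_ae_of_integral G X : G `<=` measurable -> measurable_wrt G X ->
  Pr.-integrable setT (EFin \o X) ->
  (forall A, G A -> (0 <= \int[Pr]_(w in A) (X w)%:E)%E) ->
  \forall w \ae Pr, 0 <= X w.
Proof.
move=> Gm mX iX X0.
have GA := measurable_wrt_lt 0 mX.
have mA := Gm _ GA.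
have mX' : measurable_fun setT X by exact: measurable_wrt_measurable mX.
have : (\int[Pr]_(w in [set w | (X w < 0)%R]) `|(EFin \o X) w| = 0)%E.
  apply/eqP; rewrite eq_le integral_ge0// andbT.
  rewrite (eq_integral (fun w => - (X w)%:E)%E); last first.
    by move=> w; rewrite inE/= => Xw0; rewrite ltr0_norm.
  rewrite integralN/=; last first.
    apply: integrable_add_def => //.
    exact: integrableS iX.
  by rewrite oppe_le0; exact: X0.
move/ae_eq_integral_abs => /(_ mA) H.
have {}H := H ltac:(exact/measurable_funTS/measurable_EFinP).
apply: filterS H => w /= H; rewrite leNgt; apply/negP => Xw.
by have [] := H Xw => Xw0; rewrite Xw0 ltxx in Xw.
Qed.

(** Radon-Nikodym on [G]: the charge with density [X] and the probability are both pushed forward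
    along the identity from [Omega] to [Omega] equipped with [G] alone, where a density is
    [G]-measurable by construction. *)
Lemma condexp_ex G X : sigma_algebra setT G -> G `<=` measurable ->
  Pr.-integrable setT (EFin \o X) ->
  exists Y, is_cond_expectation Pr G X Y.
Proof.
move=> sG Gm iX.
pose T' := g_sigma_algebraType G.
have midf : measurable_fun setT (id : Omega -> T').
  move=> _ B mB; rewrite setTI; apply: Gm.
  by rewrite -(measurable_g_measurableTypeE sG).
pose idf : {mfun Omega >-> T'} := HB.pack (id : Omega -> T') (isMeasurableFun.Build _ _ _ _ _ midf).
pose nu0 := (pushforward (induced_charge iX) idf : {charge set T' -> \bar R}).
pose nu := nu0 midf.

pose mu := distribution Pr idf.
have dom : nu `<< mu.
  apply/null_content_dominatesP => A mA muA.
  have mA' : measurable (A : set Omega).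
    by apply: Gm; rewrite -(measurable_g_measurableTypeE sG).
  apply: null_set_integral => //; exact: measurable_funTS (measurable_int _ iX).
have [f [ff fi fE]] : exists f : T' -> \bar R, [/\ (forall x, f x \is a fin_num),
    mu.-integrable [set: T'] f &
    forall A, measurable A -> nu A = (\int[mu]_(x in A) f x)%E].
  exists (Radon_Nikodym nu mu); split.
  - by move=> x; exact: Radon_Nikodym_fin_num.
  - exact: Radon_Nikodym_integrable.
  - by move=> A mA; exact: Radon_Nikodym_integral.
have mf : measurable_fun setT f := measurable_int _ fi.
pose Y : Omega -> R := fun w => fine (f w).
have YE w : (Y w)%:E = f w by rewrite /Y fineK.
have mfO : measurable_fun setT (f : Omega -> \bar R) by exact: (measurableT_comp mf midf).
have iY : Pr.-integrable setT (EFin \o Y).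
  apply: eq_integrable (f : Omega -> \bar R) _ _ _ => //.
    by move=> w _; rewrite /= YE.
  apply/integrableP; split => //.
  move/integrableP : fi => [_]; rewrite ge0_integral_pushforward//.
  exact: measurableT_comp.
exists Y; split => //.
  apply/measurable_wrtP => //; apply/measurable_EFinP.
  by rewrite (_ : EFin \o _ = f)//; apply/funext => w; rewrite /= YE.
move=> A GA; have mA : (measurable : set (set T')) A by rewrite measurable_g_measurableTypeE.
have := fE A mA.
rewrite integral_pushforward//; last first.
  apply: (integrableS measurableT) => //; first exact: Gm.
  by apply: eq_integrable iY => // w _; rewrite /= YE.
rewrite /nu/= /pushforward/= /induced_charge => ->.
by apply: eq_integral => w _; rewrite YE.
Qed.
End ConditionalExpectation.

(** * Excess over a level *)

Section Excess.
Context {R : realType} {d : measure_display} {Omega : measurableType d}.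
Variable Pr : probability Omega R.
Implicit Types (X xi : Omega -> R).

(** This is the stop-loss transform; comparing it at all levels is the increasing convex order. *)
Definition excess X (m : R) : \bar R :=
  (\int[Pr]_w (Num.max (X w - m) 0)%:E)%E.

Lemma measurable_excess X m : measurable_fun setT X ->
  measurable_fun setT (fun w => (Num.max (X w - m) 0)%:E).
Proof.
move=> mX; apply/measurable_EFinP; apply: measurable_maxr => //.
exact: measurable_funB.
Qed.

Lemma integral_excess_split X m (S : set Omega) : measurable_fun setT X ->
  measurable S -> 0 <= m -> (forall w, S w -> m <= X w) ->
  (\int[Pr]_(w in S) (X w)%:E =
   \int[Pr]_(w in S) (Num.max (X w - m) 0)%:E + m%:E * Pr S)%E.
Proof.
move=> mX mS m0 mle; rewrite -integral_cst//.
rewrite -ge0_integralD//.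
- apply: eq_integral => w; rewrite inE => Sw; rewrite /= -EFinD.
  by rewrite max_l ?subr_ge0 ?mle// subrK.
- by move=> w _; rewrite lee_fin le_max lexx orbT.
- exact/measurable_funTS/measurable_excess.
Qed.

(** Jensen by hand: on the event [m < X] the excess of [X] is X - m, whose integral is at most that
    of xi - m over the same event, hence at most that of its positive part over the whole space. *)
Lemma excess_le X xi m : measurable_fun setT X -> measurable_fun setT xi ->
  (forall w, 0 <= xi w) -> 0 <= m ->
  (\int[Pr]_(w in [set w | (m < X w)%R]) (X w)%:E <=
   \int[Pr]_(w in [set w | (m < X w)%R]) (xi w)%:E)%E ->
  (excess X m <= excess xi m)%E.
Proof.
move=> mX mxi xi0 m0; set S := [set w | _] => le.
have mS : measurable S.
  rewrite (_ : S = X @^-1` `]m, +oo[); last first.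
    by apply/seteqP; split => w /=; rewrite /S/= in_itv/= andbT.
  by rewrite -[X in measurable X]setTI; apply: mX => //; exact: measurable_itv.
have eS : excess X m = (\int[Pr]_(w in S) (Num.max (X w - m) 0)%:E)%E.
  rewrite /excess [RHS]integral_mkcond; apply: eq_integral => w _.
  rewrite patchE; case: ifPn => //; rewrite notin_setE /S/= => /negP.
  by rewrite -leNgt => Xm; rewrite max_r// subr_le0.
have leS : (\int[Pr]_(w in S) (Num.max (xi w - m) 0)%:E <= excess xi m)%E.
  rewrite /excess; apply: ge0_subset_integral => //.
    exact: measurable_excess.
  by move=> w _; rewrite lee_fin le_max lexx orbT.
rewrite eS; apply: le_trans leS.
have fS : (m%:E * Pr S)%E \is a fin_num by rewrite fin_numM// fin_num_measure.
(* Adding the finite quantity [m%:E * Pr S] to both sides avoids differences of extended reals. *)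
rewrite -(leeD2rE _ _ fS) -integral_excess_split//; last first.
  by move=> w /ltW.
apply: le_trans le _.
rewrite -integral_cst// -ge0_integralD//.
- apply: ge0_le_integral => //.
  + by move=> w _; rewrite lee_fin.
  + exact/measurable_funTS/measurable_EFinP.
  + exact: emeasurable_funD (measurable_funTS (measurable_excess _ mxi)) (measurable_cst _).
  + by move=> w _; rewrite -EFinD lee_fin -lerBlDr le_max lexx.
- by move=> w _; rewrite lee_fin le_max lexx orbT.
- exact/measurable_funTS/measurable_excess.
Qed.

Lemma excess_cvg xi : measurable_fun setT xi -> (forall w, 0 <= xi w) ->
  Pr.-integrable setT (EFin \o xi) ->
  excess xi n%:R @[n --> \oo] --> 0%E.
Proof.
move=> mxi xi0 ixi.
have : (\int[Pr]_w (Num.max (xi w - n%:R) 0)%:E)%E @[n --> \oo] --> (\int[Pr]_w (cst 0 w))%E.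
  have [||||| _ _ //] := @dominated_convergence _ _ _ Pr setT measurableT
    (fun n w => (Num.max (xi w - n%:R) 0)%:E) (cst 0%E) (EFin \o xi).
  - by move=> n; exact: measurable_excess.
  - exact: measurable_cst.
  - apply: aeW => w _; apply: cvg_near_cst.
    near=> n; congr (_%:E); apply/max_r; rewrite subr_le0.
    near: n; exact: nbhs_infty_ger.
  - exact: ixi.
  - apply: aeW => w n _.
    rewrite /= lee_fin ger0_norm ?le_max ?lexx ?orbT//.
    by rewrite ge_max xi0 andbT lerBlDr lerDl.
by rewrite integral0.
Unshelve. all: by end_near. Qed.
End Excess.

(** * Maximal and upcrossing inequalities *)

Section DiscreteMartingale.
Context {R : realType} {d : measure_display} {Omega : measurableType d}.
Variable Pr : probability Omega R.
Variables (G : nat -> set (set Omega)) (xi : Omega -> R) (y : nat -> Omega -> R).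
Hypothesis sG : forall k, sigma_algebra setT (G k).
Hypothesis Gm : forall k, G k `<=` measurable.
Hypothesis GG : forall j k, (j <= k)%N -> G j `<=` G k.
Hypothesis mxi : measurable_fun setT xi.
Hypothesis xi0 : forall w, 0 <= xi w.
Hypothesis my : forall k, measurable_wrt (G k) (y k).
Hypothesis y0 : forall k w, 0 <= y k w.
Hypothesis yE : forall k A, G k A ->
  (\int[Pr]_(w in A) (y k w)%:E = \int[Pr]_(w in A) (xi w)%:E)%E.

Lemma sigma_algebraI H (A B : set Omega) : sigma_algebra setT H ->
  H A -> H B -> H (A `&` B).
Proof.
move=> sH HA HB; rewrite -(measurable_g_measurableTypeE sH).
by apply: measurableI; rewrite measurable_g_measurableTypeE.
Qed.

(** Optional sampling in elementary form: each piece [S k] lies in [G k], and there the sampled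
    variable is [y k], so [yE] applies piece by piece. *)
Lemma integral_sampled (S : nat -> set Omega) (X : Omega -> R) :
  (forall k, G k (S k)) -> trivIset setT S -> measurable_fun setT X ->
  (forall k w, S k w -> X w = y k w) ->
  (\int[Pr]_(w in \bigcup_k S k) (X w)%:E =
   \int[Pr]_(w in \bigcup_k S k) (xi w)%:E)%E.
Proof.
move=> GS tS mX XE.
have mS k : measurable (S k) by apply: Gm (GS k).
rewrite !ge0_integral_bigcup//.
- apply: eq_eseriesr => k _; rewrite -(yE (GS k)).
  by apply: eq_integral => w; rewrite inE => Sw; rewrite (XE k).
- exact/measurable_funTS/measurable_EFinP.
- by move=> w _; rewrite lee_fin.
- exact/measurable_funTS/measurable_EFinP.
- by move=> w [k _ Sw]; rewrite lee_fin (XE k).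
Qed.

Lemma measurable_sampled (k : Omega -> nat) :
  (forall j, G j [set w | k w = j]) -> measurable_fun setT (fun w => y (k w) w).
Proof.
move=> Gk _ B mB; rewrite setTI.
rewrite (_ : _ @^-1` B = \bigcup_j ([set w | k w = j] `&` y j @^-1` B)).
  apply: bigcup_measurable => j _; apply: Gm.
  by apply: sigma_algebraI => //; exact: my.
apply/seteqP; split => w /=; first by move=> Bw; exists (k w).
by move=> [j _ [-> //]].
Qed.

Lemma excess_sampled (k : Omega -> nat) m :
  (forall j, G j [set w | k w = j]) -> 0 <= m ->
  (excess Pr (fun w => y (k w) w) m <= excess Pr xi m)%E.
Proof.
move=> Gk m0; have mX := measurable_sampled Gk.
apply: excess_le => //.
pose S j := [set w | k w = j] `&` [set w | m < y j w].
have -> : [set w | m < y (k w) w] = \bigcup_j S j.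
  apply/seteqP; split => w /=; first by move=> mw; exists (k w).
  by move=> [j _ [<-]].
rewrite integral_sampled//.
- by move=> j; apply: sigma_algebraI => //; exact: measurable_wrt_gt.
- by apply/trivIsetP => i j _ _ ij; apply/seteqP; split => // w [[/= ki _] [/= kj _]];
    rewrite -ki -kj eqxx in ij.
- by move=> j w [<-].
Qed.

(** [seqDU] cuts the event by the first index at which [y] reaches [c]. Each piece lies in the
    sigma-algebra of that index, where [y k] may be exchanged for [xi] under the integral. *)
Lemma maximal_ineq (c : R) : 0 <= c ->
  (c%:E * Pr (\bigcup_k [set w | (c <= y k w)%R]) <= \int[Pr]_w (xi w)%:E)%E.
Proof.
move=> c0; rewrite seqDU_bigcup_eq; set S := seqDU _.
have GS k : G k (S k).
  rewrite -(measurable_g_measurableTypeE (sG k)); apply: measurableD.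
    by rewrite measurable_g_measurableTypeE//; exact: measurable_wrt_ge.
  apply: bigsetU_measurable => j _.
  rewrite measurable_g_measurableTypeE//; apply: (GG (ltnW (ltn_ord j))).
  exact: measurable_wrt_ge.
have mS k : measurable (S k) by apply: Gm (GS k).
have mU : measurable (\bigcup_k S k) by exact: bigcup_measurable.
rewrite -integral_cst//.
apply: (@le_trans _ _ (\int[Pr]_(w in \bigcup_k S k) (xi w)%:E)%E).
  rewrite !ge0_integral_bigcup//.
  - apply: lee_nneseries => [k _ _|k _].
      by apply: integral_ge0 => w _; rewrite lee_fin.
    rewrite -(yE (GS k)); apply: ge0_le_integral => //.
    + exact/measurable_funTS/measurable_EFinP/(measurable_wrt_measurable _ (my k)).
    + by move=> w [/=]; rewrite lee_fin.
  - exact/measurable_funTS/measurable_EFinP.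
  - by move=> w _; rewrite lee_fin.
  - exact: trivIset_seqDU.
  - exact: trivIset_seqDU.
apply: ge0_subset_integral => //; first exact/measurable_EFinP.
by move=> w _; rewrite lee_fin.
Qed.

End DiscreteMartingale.

Section Upcrossings.
Context {R : realType}.
Variables (a b : R).

(* Buying below [a] and selling at or above [b]: [holding y k] says that the
   asset is held between times [k] and [k + 1]. *)
Fixpoint holding (y : nat -> R) (k : nat) : bool :=
  if k is j.+1 then if holding y j then y k < b else y k < a else y 0%N < a.

Fixpoint upcrossings (y : nat -> R) (k : nat) : nat :=
  if k is j.+1 then (upcrossings y j + (holding y j && ~~ holding y k))%N
  else 0%N.

Lemma upcrossings_mono y i j : (i <= j)%N ->
  (upcrossings y i <= upcrossings y j)%N.
Proof.
move=> /subnK <-; elim: (j - i)%N => [//|k IH].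
by rewrite addSn/= (leq_trans IH)// leq_addr.
Qed.

(** The asset is held at [i] and no longer at [j], so a sale takes place in between. *)
Lemma upcrossings_lt y i j : a < b -> (i <= j)%N -> y i < a -> b <= y j ->
  (upcrossings y i < upcrossings y j)%N.
Proof.
move=> ab ij yi yj.
have hi : holding y i.
  by case: i yi {ij} => [|i] /= yi//; case: ifP => // _; exact: lt_trans ab.
have hj : ~~ holding y j.
  case: j yj {ij} => [|j] /= yj; first by rewrite -leNgt (le_trans _ yj)// ltW.
  by case: ifP => _; rewrite -leNgt// (le_trans _ yj)// ltW.
(* The invariant for the induction: from [i] on, being out of the market certifies one sale. *)
suff H : (upcrossings y i + ~~ holding y j <= upcrossings y j)%N.
  by move: H; rewrite hj addn1.
move: ij => /subnK <-; elim: (j - i)%N => [|k IH].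
  by rewrite add0n hi addn0.
rewrite addSn/=; move: IH.
case: (holding y (k + i)) => /=; case: (_ < _) => //=; rewrite ?addn0 ?addn1 ?ltnS//.
exact: ltnW.
Qed.

End Upcrossings.

Section UpcrossingInequality.
Context {R : realType} {d : measure_display} {Omega : measurableType d}.
Variable Pr : probability Omega R.
Variables (G : nat -> set (set Omega)) (xi : Omega -> R) (y : nat -> Omega -> R).
Hypothesis sG : forall k, sigma_algebra setT (G k).
Hypothesis Gm : forall k, G k `<=` measurable.
Hypothesis GG : forall j k, (j <= k)%N -> G j `<=` G k.
Hypothesis my : forall k, measurable_wrt (G k) (y k).
Hypothesis y0 : forall k w, 0 <= y k w.
Hypothesis yE : forall k A, G k A ->
  (\int[Pr]_(w in A) (y k w)%:E = \int[Pr]_(w in A) (xi w)%:E)%E.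
Variables (a b : R).
Hypothesis a0 : 0 <= a.
Hypothesis ab : a < b.

Let H k := [set w | holding a b (y ^~ w) k].
Let U k w : R := (upcrossings a b (y ^~ w) k)%:R.

Lemma holding_mem k : G k (H k).
Proof.
elim: k => [|k IH]; first exact: measurable_wrt_lt.
have -> : H k.+1 = (H k `&` [set w | y k.+1 w < b]) `|`
                   (~` H k `&` [set w | y k.+1 w < a]).
  apply/seteqP; split => w; rewrite /H/=; case: ifP => hk.
  - by move=> ?; left; split.
  - by move=> ?; right; split.
  - by move=> [[]|[]].
  - by move=> [[]|[]].
have GHk : G k.+1 (H k) by exact: GG IH.
rewrite -(measurable_g_measurableTypeE (sG k.+1)).
apply: measurableU; apply: measurableI.
- by rewrite measurable_g_measurableTypeE.
- by rewrite measurable_g_measurableTypeE//; exact: measurable_wrt_lt.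
- by apply: measurableC; rewrite measurable_g_measurableTypeE.
- by rewrite measurable_g_measurableTypeE//; exact: measurable_wrt_lt.
Qed.

Let mH k : measurable (H k). Proof. by apply: Gm (holding_mem k). Qed.

Lemma measurable_upcrossings k : measurable_fun setT (U k).
Proof.
elim: k => [|k IH]; first exact: measurable_cst.
have -> : U k.+1 = U k \+ \1_(H k `\` H k.+1).
  apply/funext => w; rewrite /U /= natrD indicE; congr (_ + _).
  by rewrite in_setD !mem_setE/= /in_mem/=.
apply: measurable_funD => //; apply: measurable_indic; exact: measurableD.
Qed.

Let my' k : measurable_fun setT (y k).
Proof. exact: measurable_wrt_measurable (my k). Qed.

Let hold_integral k j : (\int[Pr]_w (if w \in H k then y j w else a)%:E =
  \int[Pr]_(w in H k) (y j w)%:E + \int[Pr]_(w in ~` H k) a%:E)%E.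
Proof.
rewrite -(setUv (H k)) ge0_integral_setU//.
- congr (_ + _)%E; apply: eq_integral => w; first by move=> ->.
  by rewrite in_setC => /negbTE ->.
- exact: measurableC.
- apply/measurable_EFinP/measurable_funTS/measurable_fun_ifT => //.
  by apply: (measurable_fun_bool true); rewrite setTI preimage_mem_true.
- by move=> w _; rewrite lee_fin; case: ifP.
- by rewrite disj_set2E setICr.
Qed.

Let measurable_hold k j : measurable_fun setT (fun w => if w \in H k then y j w else a).
Proof.
apply/measurable_fun_ifT => //.
by apply: (measurable_fun_bool true); rewrite setTI preimage_mem_true.
Qed.

(** Consider (b - a) [U k] plus the asset if held, or [a] if not. A sale exchanges some y >= b for
    (b - a) + a, a purchase exchanges [a] for some y < a, and holding preserves the mean because
    [y k] and [y k.+1] have the integral of [xi] on [H k]. So the mean never increases, and it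
    starts at most at [a]. The bound depends neither on [k] nor on the grid. *)
Lemma upcrossing_ineq k : ((b - a)%:E * \int[Pr]_w (U k w)%:E <= a%:E)%E.
Proof.
have ba0 : 0 <= b - a by rewrite subr_ge0 ltW.
have U0 j w : 0 <= U j w by rewrite ler0n.
have hold0 i j w : 0 <= if w \in H i then y j w else a by case: ifP.
have split i j : (\int[Pr]_w ((b - a) * U i w + if w \in H i then y j w else a)%:E =
    (b - a)%:E * \int[Pr]_w (U i w)%:E +
    \int[Pr]_w (if w \in H i then y j w else a)%:E)%E.
  under eq_integral do rewrite EFinD.
  rewrite ge0_integralD//.
  - under eq_integral do rewrite EFinM.
    rewrite ge0_integralZl//; first exact/measurable_EFinP/measurable_upcrossings.
    by move=> w _; rewrite lee_fin.
  - by move=> w _; rewrite lee_fin mulr_ge0.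
  - apply/measurable_EFinP; apply: measurable_funM => //.
    exact: measurable_upcrossings.
  - by move=> w _; rewrite lee_fin.
  - exact/measurable_EFinP.
have mT i j : measurable_fun setT
    (fun w => ((b - a) * U i w + if w \in H i then y j w else a)%:E).
  apply/measurable_EFinP; apply: measurable_funD => //.
  by apply: measurable_funM => //; exact: measurable_upcrossings.
have T0 i j w : 0 <= (b - a) * U i w + if w \in H i then y j w else a.
  by rewrite addr_ge0// mulr_ge0.
suff main : (\int[Pr]_w ((b - a) * U k w + if w \in H k then y k w else a)%:E <= a%:E)%E.
  apply: le_trans main; rewrite split leeDl//.
  by apply: integral_ge0 => w _; rewrite lee_fin.
elim: k => [|k IH].
  apply: (@le_trans _ _ (\int[Pr]_w a%:E)%E); last first.
    have -> := integral_cst Pr measurableT a%:E.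
    by rewrite [X in (_ * X)%E]probability_setT mule1.
  apply: ge0_le_integral => //.
  - by move=> w _; rewrite lee_fin.
  - move=> w _; rewrite lee_fin /U/= mulr0 add0r /H/=.
    by case: ifPn => //; rewrite inE/= => /ltW.
apply: (@le_trans _ _ (\int[Pr]_w ((b - a) * U k w + if w \in H k then y k.+1 w else a)%:E)%E).
  apply: ge0_le_integral => //.
  - by move=> w _; rewrite lee_fin.
  - move=> w _; rewrite lee_fin /U/= natrD mulrDr -addrA lerD2l.
    rewrite !mem_setE /in_mem/= /H/=.
    case: (holding a b (y ^~ w) k) => /=.
      by case: ltP => /= hb; [rewrite mulr0 add0r|rewrite mulr1 subrK].
    by rewrite mulr0 add0r; case: ltP => // /ltW.
rewrite split hold_integral yE; last exact: GG (holding_mem k).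
by rewrite -(yE (holding_mem k)) -hold_integral -split.
Qed.

End UpcrossingInequality.

(** * One-sided limits along the dyadic numbers *)

Section Dyadic.
Context {R : realType}.
Implicit Types (x t q : R).

Definition grid (n k : nat) : R := k%:R / 2 ^+ n.

Definition dyadic : set R := [set q | exists n k, q = grid n k].

Lemma grid_ge0 n k : 0 <= grid n k.
Proof. by rewrite divr_ge0// exprn_ge0. Qed.

Lemma grid_le n i j : (grid n i <= grid n j) = (i <= j)%N.
Proof. by rewrite ler_pM2r ?ler_nat// invr_gt0 exprn_gt0. Qed.

Lemma grid_refine n k p : grid (p + n) (k * 2 ^ p)%N = grid n k.
Proof.
rewrite /grid natrM natrX exprD [_ ^+ p * _]mulrC -mulf_div divff ?mulr1//.
Qed.

Lemma grid_int n K : grid n (K * 2 ^ n)%N = K%:R.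
Proof. by rewrite -[n in grid n _]addn0 grid_refine /grid expr0 divr1. Qed.

Lemma dyadic_level q : dyadic q ->
  exists n0, forall n, (n0 <= n)%N -> exists k, grid n k = q.
Proof.
move=> [n0 [k ->]]; exists n0 => n /subnK <-.
by exists (k * 2 ^ (n - n0))%N; rewrite grid_refine.
Qed.

Lemma exprn2_gt x : exists n, x < 2 ^+ n.
Proof.
exists (Num.truncn x).+1; apply: lt_trans (truncnS_gt x) _.
by rewrite -natrX ltr_nat ltn_expl.
Qed.

Lemma invexpr2_lt x : 0 < x -> exists n, (2 ^+ n)^-1 < x.
Proof.
move=> x0; have [n xn] := exprn2_gt x^-1; exists n.
by rewrite invf_plt// ?posrE ?exprn_gt0.
Qed.

(** Rounding up is strict, as needed for right limits, which ignore the value at [t] itself. *)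
Definition next_index n t : nat := (Num.truncn (t * 2 ^+ n)).+1.

Lemma next_index_gt n t : t < grid n (next_index n t).
Proof. by rewrite ltr_pdivlMr ?exprn_gt0// truncnS_gt. Qed.

Lemma next_index_le n t : 0 <= t -> grid n (next_index n t) <= t + (2 ^+ n)^-1.
Proof.
move=> t0; rewrite /grid /next_index -natr1 mulrDl mul1r lerD2r.
by rewrite ler_pdivrMr ?exprn_gt0// truncn_le mulr_ge0// exprn_ge0.
Qed.

Lemma dyadic_between x t : 0 <= x -> x < t -> exists2 q, dyadic q & x < q < t.
Proof.
move=> x0 xt; have [|n nt] := @invexpr2_lt (t - x); first by rewrite subr_gt0.
exists (grid n (next_index n x)); first by exists n, (next_index n x).
rewrite next_index_gt/= (le_lt_trans (next_index_le _ x0))//.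
by rewrite addrC -ltrBrDr.
Qed.

End Dyadic.

Section OneSidedLimits.
Context {R : realType}.
Variables (f : R -> R) (C : R).

Definition dyadic_right (t e : R) : set R := [set q | dyadic q /\ t < q < t + e].
Definition dyadic_left (t e : R) : set R := [set q | dyadic q /\ t - e < q < t].

Definition dyadic_limit (D : R -> set R) (l : R) :=
  forall e, 0 < e -> exists2 del, 0 < del & forall q, D del q -> `|f q - l| <= e.

Hypothesis fC : forall q, dyadic q -> 0 <= f q <= C.
Hypothesis few_upcrossings : forall (a b : rat) (K : nat), 0 < a -> a < b ->
  exists m : nat, forall n0 : nat, exists2 n, (n0 <= n)%N &
    (upcrossings (ratr a) (ratr b) (fun k => f (grid n k)) (K * 2 ^ n) <= m)%N.

Section Chains.
Variables (a b : R).
Let u n k := upcrossings a b (fun k => f (grid n k)) k.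

(** Upcrossings from [q] to [r] are measured as an increment of the one counter started at time 0,
    so consecutive chains add up. Requiring them on all fine grids lets a chain contradict
    [few_upcrossings], which bounds the count only along infinitely many levels. *)
Definition chain (m : nat) (q r : R) := exists n0, forall n i j, (n0 <= n)%N ->
  grid n i = q -> grid n j = r -> (u n i + m <= u n j)%N.

Lemma chain0 q r : q <= r -> chain 0 q r.
Proof.
move=> qr; exists 0%N => n i j _ iq jr.
by rewrite addn0 upcrossings_mono// -(@grid_le R n) iq jr.
Qed.

Lemma chain1 q r : a < b -> q <= r -> f q < a -> b <= f r -> chain 1 q r.
Proof.
move=> ab qr fq fr; exists 0%N => n i j _ iq jr.
by rewrite addn1 upcrossings_lt// ?iq ?jr// -(@grid_le R n) iq jr.
Qed.

Lemma chain_cat m m' q r s : dyadic r -> chain m q r -> chain m' r s ->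
  chain (m + m') q s.
Proof.
move=> /dyadic_level[n0 dr] [n1 c1] [n2 c2].
exists (maxn n0 (maxn n1 n2)) => n i j; rewrite !geq_max => /and3P[h0 h1 h2] iq js.
have [k kr] := dr _ h0.
by rewrite addnA (leq_trans _ (c2 n k j h2 kr js))// leq_add2r c1.
Qed.

End Chains.

Lemma chain_bounded (a b : rat) (K : nat) : 0 < a -> a < b ->
  ~ (forall m, exists q r, [/\ dyadic q, dyadic r, r <= K%:R &
       chain (ratr a) (ratr b) m q r]).
Proof.
move=> a0 ab H; have [m few] := few_upcrossings K a0 ab.
have [q [r [/dyadic_level[n1 dq] /dyadic_level[n2 dr] rK [n0 ch]]]] := H m.+1.
have [n] := few (maxn n0 (maxn n1 n2)).
rewrite !geq_max => /and3P[h0 h1 h2] um.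
have [i iq] := dq _ h1; have [j jr] := dr _ h2.
have := ch n i j h0 iq jr; apply/negP; rewrite -ltnNge.
have jK : (j <= K * 2 ^ n)%N by rewrite -(@grid_le R n) jr grid_int.
rewrite addnS ltnS; apply: leq_trans (upcrossings_mono _ _ _ jK) _.
by rewrite (leq_trans um)// leq_addl.
Qed.

(** Chains are extended at the front, towards [t]: before a chain starting at [q], a low point [l]
    and a high point [h] are inserted with t < l < h < q. All points stay below t + 1, which fixes
    the horizon. *)
Lemma no_oscillation_right (t : R) (a b : rat) : 0 <= t -> 0 < a -> a < b ->
  ~ ((forall e, 0 < e -> exists2 q, dyadic_right t e q & f q < ratr a) /\
     (forall e, 0 < e -> exists2 q, dyadic_right t e q & ratr b <= f q)).
Proof.
move=> t0 a0 ab [lo hi].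
have ab' : ratr a < ratr b :> R by rewrite ltr_rat.
apply: (@chain_bounded a b (Num.truncn (t + 1)).+1 a0 ab).
have H m e : 0 < e -> exists q r, [/\ dyadic_right t e q, dyadic_right t e r &
    chain (ratr a) (ratr b) m q r].
  elim: m e => [|m IH] e e0.
    have [q Dq _] := lo e e0.
    by exists q, q; split => //; exact: chain0.
  have [q [r [[dq /andP[tq qe]] [dr /andP[tr re]] ch]]] := IH e e0.
  have [|h [dh /andP[th hq]] fh] := hi (q - t); first by rewrite subr_gt0.
  have [|l [dl /andP[tl lh]] fl] := lo (h - t); first by rewrite subr_gt0.
  move: hq lh; rewrite ![t + _]addrC !subrK => hq lh.
  exists l, r; split => //.
    by split => //; rewrite tl/= (lt_trans lh)// (lt_trans hq).
    by split => //; rewrite tr.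
  rewrite -[m.+1]add1n; apply: (chain_cat dq) ch.
  rewrite -[1%N]addn0; apply: (chain_cat dh); first exact: chain1 (ltW lh) _ _.
  exact/chain0/ltW.
move=> m; have [q [r [[dq _] [dr /andP[_ re]] ch]]] := H m 1 ltr01.
exists q, r; split => //.
by rewrite ltW// (lt_trans re)// truncnS_gt.
Qed.

(** Here chains are extended at the end: a low and then a high point are appended between the last
    point and [t], which serves as horizon. *)
Lemma no_oscillation_left (t : R) (a b : rat) : 0 < a -> a < b ->
  ~ ((forall e, 0 < e -> exists2 q, dyadic_left t e q & f q < ratr a) /\
     (forall e, 0 < e -> exists2 q, dyadic_left t e q & ratr b <= f q)).
Proof.
move=> a0 ab [lo hi].
have ab' : ratr a < ratr b :> R by rewrite ltr_rat.
apply: (@chain_bounded a b (Num.truncn t).+1 a0 ab).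
have H m : exists q r, [/\ dyadic q, dyadic r, r < t &
    chain (ratr a) (ratr b) m q r].
  elim: m => [|m [q [r [dq dr rt ch]]]].
    have [q [dq /andP[_ qt]] _] := lo 1 ltr01.
    by exists q, q; split => //; exact: chain0.
  have [|l [dl /andP[rl lt]] fl] := lo (t - r); first by rewrite subr_gt0.
  have [|h [dh /andP[lh ht]] fh] := hi (t - l); first by rewrite subr_gt0.
  move: rl lh; rewrite !opprB ![t + _]addrC !subrK => rl lh.
  exists q, h; split => //.
  rewrite -[m.+1]addn1; apply: (chain_cat dr) ch _.
  rewrite -[1%N]add0n; apply: (chain_cat dl); first exact/chain0/ltW.
  exact: chain1 (ltW lh) _ _.
move=> m; have [q [r [dq dr rt ch]]] := H m.
exists q, r; split => //.
by rewrite ltW// (lt_trans rt)// truncnS_gt.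
Qed.

(** The limit is the lower limit, written as the supremum of the eventual lower bounds [S]. If it
    were exceeded by some [e] arbitrarily late, two rationals a < b would fit in the gap and [f]
    would oscillate across them; a > 0 because f >= 0. *)
Lemma dyadic_limit_ex (D : R -> set R) :
  (forall e e', e <= e' -> D e `<=` D e') ->
  (forall e, 0 < e -> D e !=set0) -> (forall e, D e `<=` dyadic) ->
  (forall a b : rat, 0 < a -> a < b ->
    ~ ((forall e, 0 < e -> exists2 q, D e q & f q < ratr a) /\
       (forall e, 0 < e -> exists2 q, D e q & ratr b <= f q))) ->
  exists l, dyadic_limit D l.
Proof.
move=> Dmono Dne Ddy osc.
pose S := [set r | exists2 e, 0 < e & forall q, D e q -> r <= f q].
have S0 : S 0 by exists 1 => // q /Ddy /fC /andP[].
have SC : ubound S C.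
  move=> r [e e0 rf]; have [q Dq] := Dne e e0.
  by rewrite (le_trans (rf q Dq))//; have /andP[] := fC (Ddy _ _ Dq).
have hS : has_sup S by split; [exists 0|exists C].
have l0 : 0 <= sup S by exact: sup_upper_bound.
exists (sup S) => e e0.
have [r [e1 e10 rf] lr] := sup_adherent e0 hS.
have [[e2 e20 rf2]|no] := pselect (exists2 e2, 0 < e2 &
    forall q, D e2 q -> f q <= sup S + e).
  exists (Num.min e1 e2); first by rewrite lt_min e10.
  move=> q Dq; rewrite ler_norml lerBrDr lerBlDr.
  rewrite [X in _ && X](le_trans (rf2 q _)) ?[X in _ + X]addrC//=; last first.
  - by rewrite addrC.
  - by apply: Dmono Dq; rewrite ge_min lexx orbT.
  rewrite andbT addrC (le_trans (ltW lr))// rf//.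
  by apply: Dmono Dq; rewrite ge_min lexx.
exfalso.
have [b] := @rat_in_itvoo R (sup S) (sup S + e) ltac:(by rewrite ltrDl).
rewrite in_itv/= => /andP[lb be].
have [a] := @rat_in_itvoo R (sup S) (ratr b) lb.
rewrite in_itv/= => /andP[la ab].
have a0 : 0 < a by rewrite -(@ltr0q R) (le_lt_trans l0).
have ab' : a < b by rewrite -(@ltr_rat R).
apply: (osc a b a0 ab'); split => e' e'0; apply: contrapT => H.
  have : S (ratr a).
    exists e' => // q Dq; rewrite leNgt; apply/negP => fa.
    by apply: H; exists q.
  by move/(sup_upper_bound hS); rewrite leNgt la.
apply: no; exists e' => // q Dq; rewrite leNgt; apply/negP => fq.
by apply: H; exists q => //; rewrite ltW// (lt_trans be).
Qed.

Lemma dyadic_right_limit (t : R) : 0 <= t ->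
  exists l, dyadic_limit (dyadic_right t) l.
Proof.
move=> t0; apply: dyadic_limit_ex.
- move=> e e' ee' q [dq /andP[tq qe]]; split => //.
  by rewrite tq/= (lt_le_trans qe)// lerD2l.
- move=> e e0; have [|q dq tq] := @dyadic_between R t (t + e) t0.
    by rewrite ltrDl.
  by exists q.
- by move=> e q [].
- by move=> a b; exact: no_oscillation_right.
Qed.

Lemma dyadic_left_limit (t : R) : 0 < t ->
  exists l, dyadic_limit (dyadic_left t) l.
Proof.
move=> t0; apply: dyadic_limit_ex.
- move=> e e' ee' q [dq /andP[tq qe]]; split => //.
  by rewrite qe andbT (le_lt_trans _ tq)// lerD2l lerN2.
- move=> e e0; have [||q dq /andP[tq qt]] := @dyadic_between R (Num.max 0 (t - e)) t.
  + by rewrite le_max lexx.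
  + by rewrite gt_max t0 ltrBlDr ltrDl.
  by exists q; split => //; rewrite qt (le_lt_trans _ tq)// le_max lexx orbT.
- by move=> e q [].
- by move=> a b; exact: no_oscillation_left.
Qed.

End OneSidedLimits.

(** * Right-continuous versions of closed martingales *)

Section Convergence.
Context {R : realType} {d : measure_display} {Omega : measurableType d}.
Variable Pr : probability Omega R.

Lemma fatou_bound (A : set Omega) (X_ : nat -> Omega -> R) (X : Omega -> R)
    (c : \bar R) :
  measurable A -> (forall n, measurable_fun setT (X_ n)) ->
  (forall n w, 0 <= X_ n w) -> measurable_fun setT X -> (forall w, 0 <= X w) ->
  (\forall w \ae Pr, X_ n w @[n --> \oo] --> X w) ->
  (forall n, \int[Pr]_(w in A) (X_ n w)%:E <= c)%E ->
  (\int[Pr]_(w in A) (X w)%:E <= c)%E.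
Proof.
move=> mA mX_ X_0 mX X0 cX Xc.
pose f n w := (X_ n w)%:E.
have mf n : measurable_fun A (f n) by exact/measurable_funTS/measurable_EFinP.
have f0 n w : A w -> (0 <= f n w)%E by move=> _; rewrite lee_fin.
have -> : (\int[Pr]_(w in A) (X w)%:E = \int[Pr]_(w in A) limn_einf (f^~ w))%E.
  apply: ge0_ae_eq_integral => //.
  - exact/measurable_funTS/measurable_EFinP.
  - apply: (eq_measurable_fun (fun x => - limn_esup (fun n => - f n x)))%E.
      by [].
    apply: measurableT_comp => //; apply: measurable_fun_limn_esup => n.
    exact: measurableT_comp.
  - by move=> w _; rewrite lee_fin.
  - move=> w Aw; rewrite limn_einf_lim; apply: lime_ge; first exact: is_cvg_einfs.
    apply: nearW => n; apply: le_ereal_inf_tmp => _ [m _ <-]; exact: f0.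
  - apply: filterS cX => w cw _.
    have fw : (f^~ w) n @[n --> \oo] --> (X w)%:E by apply: cvg_EFin => //; exact: nearW.
    by have [-> _] := cvg_limn_einf_sup fw.
apply: le_trans (fatou _ mA mf f0) _.
rewrite limn_einf_lim; apply: lime_le; first exact: is_cvg_einfs.
apply: nearW => n; apply: le_trans (Xc n).
by apply: ereal_inf_lbound; exists n => /=.
Qed.

(** Letting [n] grow in the hypothesis shows that the intersection has probability at most C / c for
    every positive [c]. *)
Lemma negligible_tail (E : nat -> nat -> set Omega) (C : R) :
  (forall c n, measurable (E c n)) -> (forall c, nondecreasing_seq (E c)) ->
  (forall c n, (c%:R%:E * Pr (E c n) <= C%:E)%E) ->
  Pr.-negligible (\bigcap_c \bigcup_n E c n).
Proof.
move=> mE ndE EC.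
have mU c : measurable (\bigcup_n E c n) by exact: bigcup_measurable.
have mI : measurable (\bigcap_c \bigcup_n E c n) by exact: bigcap_measurable.
exists (\bigcap_c \bigcup_n E c n); split => //.
set I := \bigcap_c _.
have UC c : (c%:R%:E * Pr (\bigcup_n E c n) <= C%:E)%E.
  have cU : (c%:R%:E * Pr (E c n))%E @[n --> \oo] --> (c%:R%:E * Pr (\bigcup_n E c n))%E.
    by apply: cvgeZl => //; exact: nondecreasing_cvg_mu.
  by apply: (cvge_to_le cU); apply: nearW => n; exact: EC.
have IC c : (c%:R%:E * Pr I <= C%:E)%E.
  apply: le_trans (UC c); apply: lee_wpmul2l; first by rewrite lee_fin.
  by apply: le_measure; rewrite ?inE//; exact: bigcap_inf.
have fI : Pr I \is a fin_num by exact: fin_num_measure.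
apply/eqP; rewrite -(fineK fI) eqe; apply/eqP/le_anti; rewrite fine_ge0//= andbT.
rewrite leNgt; apply/negP => p0.
have := IC (Num.truncn (C / fine (Pr I))).+1.
rewrite -(fineK fI) -EFinM lee_fin leNgt => /negP; apply.
by rewrite -ltr_pdivrMr// truncnS_gt.
Qed.

End Convergence.

Section Filtrations.
Context {R : realType} {d : measure_display} {Omega : measurableType d}.
Variable Pr : probability Omega R.
Variable F : R -> set (set Omega).

(** The positive part of a version differs from it on a null set only, and it provides the sign at
    every point, as the path arguments assume. *)
Lemma condexp_ge0_ex G (X : Omega -> R) : sigma_algebra setT G -> G `<=` measurable ->
  Pr.-integrable setT (EFin \o X) -> (forall w, 0 <= X w) ->
  exists2 Y, is_cond_expectation Pr G X Y & forall w, 0 <= Y w.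
Proof.
move=> sG Gm iX X0; have [Y [mY iY YE]] := condexp_ex sG Gm iX.
have Y0 : \forall w \ae Pr, 0 <= Y w.
  apply: ge0_ae_of_integral mY _ _ => // A GA.
  by rewrite YE//; apply: integral_ge0 => w _; rewrite lee_fin.
have mY' : measurable_wrt G (fun w => Num.max (Y w) 0).
  apply/measurable_wrtP => //; apply: measurable_maxr => //.
  exact/measurable_wrtP.
have YY' : \forall w \ae Pr, (Y w)%:E = (Num.max (Y w) 0)%:E.
  by apply: filterS Y0 => w Yw; rewrite max_l.
exists (fun w => Num.max (Y w) 0); last by move=> w; rewrite le_max lexx orbT.
split => //.
- by apply: integrable_funrpos.
- move=> A GA; rewrite -YE//; apply/esym/ae_eq_integral.
  + exact: Gm.
  + exact/measurable_funTS/(measurable_int _ iY).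
  + exact/measurable_funTS/measurable_EFinP/measurable_wrt_measurable/mY'.
  + by apply: filterS YY' => w.
Qed.

Hypothesis fF : filtration F.
Hypothesis uF : usual_conditions Pr F.

Let sF t : 0 <= t -> sigma_algebra setT (F t). Proof. by case: fF => + _ _; exact. Qed.
Let Fm t : 0 <= t -> F t `<=` measurable. Proof. by case: fF => _ + _; exact. Qed.
Let FF s t : 0 <= s -> s <= t -> F s `<=` F t. Proof. by case: fF => _ _; exact. Qed.

Lemma negligible_filtration t A : 0 <= t -> Pr.-negligible A -> F t A.
Proof. by move=> t0 nA; apply: (FF _ t0) => //; case: uF => + _; exact. Qed.

(** Preimages under [X] and [Y] differ by negligible sets, which completeness puts in [F 0], hence
    in [F t]. *)
Lemma measurable_wrt_ae t (X Y : Omega -> R) : 0 <= t ->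
  (\forall w \ae Pr, X w = Y w) ->
  measurable_wrt (F t) X -> measurable_wrt (F t) Y.
Proof.
move=> t0 XY mX B mB.
have FN N : N `<=` [set w | ~ X w = Y w] -> F t N.
  by move=> NN; apply: negligible_filtration => //; exact: negligibleS NN XY.
have sT := measurable_g_measurableTypeE (sF t0).
have -> : Y @^-1` B = (X @^-1` B `\` (X @^-1` B `\` Y @^-1` B)) `|` (Y @^-1` B `\` X @^-1` B).
  apply/seteqP; split => w /=.
    move=> YB; have [XB|XB] := pselect (B (X w)); [left|right] => //.
    by split => // -[].
  by move=> [[XB H]|[]//]; apply: contrapT => YB; apply: H.
rewrite -sT; apply: measurableU; first apply: measurableD; rewrite sT.
- exact: mX.
- by apply: FN => w [/= XB YB]; apply: contra_not YB => <-.
- by apply: FN => w [/= YB XB]; apply: contra_not XB => ->.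
Qed.

Lemma measurable_wrt_right t (X : Omega -> R) : 0 <= t ->
  (forall u, t < u -> measurable_wrt (F u) X) -> measurable_wrt (F t) X.
Proof.
move=> t0 mX B mB; case: uF => _ /(_ t t0); apply => u /= tu.
exact: mX.
Qed.

Lemma measurable_wrt_cvg G (X_ : nat -> Omega -> R) (X : Omega -> R) :
  sigma_algebra setT G ->
  (forall n, measurable_wrt G (X_ n)) ->
  (forall w, X_ n w @[n --> \oo] --> X w) -> measurable_wrt G X.
Proof.
move=> sG mX cX; apply/measurable_wrtP => //.
apply: (@measurable_fun_cvg _ (g_sigma_algebraType G) R setT X_ X) => // n.
exact/measurable_wrtP.
Qed.

End Filtrations.

Section CadlagVersion.
Context {R : realType} {d : measure_display} {Omega : measurableType d}.
Variable Pr : probability Omega R.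
Variable F : R -> set (set Omega).
Hypothesis fF : filtration F.
Variable xi : Omega -> R.
Hypothesis mxi : measurable_fun setT xi.
Hypothesis xi0 : forall w, 0 <= xi w.
Hypothesis ixi : Pr.-integrable setT (EFin \o xi).
Variable Y : R -> Omega -> R.
Hypothesis Y0 : forall s w, 0 <= Y s w.
Hypothesis mY : forall s, 0 <= s -> measurable_wrt (F s) (Y s).
Hypothesis YE : forall s A, 0 <= s -> F s A ->
  (\int[Pr]_(w in A) (Y s w)%:E = \int[Pr]_(w in A) (xi w)%:E)%E.

Let sF t : 0 <= t -> sigma_algebra setT (F t). Proof. by case: fF => + _ _; exact. Qed.
Let Fm t : 0 <= t -> F t `<=` measurable. Proof. by case: fF => _ + _; exact. Qed.
Let FF s t : 0 <= s -> s <= t -> F s `<=` F t. Proof. by case: fF => _ _; exact. Qed.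

Let sG n k : sigma_algebra setT (F (grid n k)). Proof. exact/sF/grid_ge0. Qed.
Let Gm n k : F (grid n k) `<=` measurable. Proof. exact/Fm/grid_ge0. Qed.
Let GG n j k : (j <= k)%N -> F (grid n j) `<=` F (grid n k).
Proof. by move=> jk; apply: FF; rewrite ?grid_ge0// grid_le. Qed.
Let myG n k : measurable_wrt (F (grid n k)) (Y (grid n k)).
Proof. exact/mY/grid_ge0. Qed.
Let YGE n k A : F (grid n k) A ->
  (\int[Pr]_(w in A) (Y (grid n k) w)%:E = \int[Pr]_(w in A) (xi w)%:E)%E.
Proof. exact/YE/grid_ge0. Qed.

(** These are the hypotheses under which one-sided limits along the dyadics exist. Only dyadic times
    and rational levels enter, which keeps the exceptional set negligible. *)
Definition regular_path (f : R -> R) :=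
  (exists C, forall q, dyadic q -> 0 <= f q <= C) /\
  (forall (a b : rat) (K : nat), 0 < a -> a < b ->
    exists m : nat, forall n0 : nat, exists2 n, (n0 <= n)%N &
    (upcrossings (ratr a) (ratr b) (fun k => f (grid n k)) (K * 2 ^ n) <= m)%N).

(** Grids refine one another, so [E c n] increases with [n], while the maximal inequality bounds c
    Pr(E c n) by the mean of [xi] on every grid. *)
Lemma bounded_path_ae :
  \forall w \ae Pr, exists C, forall q, dyadic q -> 0 <= Y q w <= C.
Proof.
pose E (c n : nat) := \bigcup_k [set w | c%:R <= Y (grid n k) w].
have mE c n : measurable (E c n).
  apply: bigcup_measurable => k _; apply: (Gm (n := n) (k := k)).
  exact: measurable_wrt_ge.
have ndE c : nondecreasing_seq (E c).
  apply/nondecreasing_seqP => n; apply/subsetPset => w [k _ /= ck].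
  by exists (k * 2 ^ 1)%N => //=; rewrite -[n.+1]add1n grid_refine.
have fxi : (\int[Pr]_w (xi w)%:E)%E \is a fin_num by exact: integrable_fin_num.
have EC c n : (c%:R%:E * Pr (E c n) <= (fine (\int[Pr]_w (xi w)%:E))%:E)%E.
  rewrite fineK//.
  exact: (maximal_ineq (sG n) (@Gm n) (@GG n) mxi xi0 (myG n) (@YGE n)).
apply: negligibleS (negligible_tail mE ndE EC) => w H c _.
apply: contrapT => NE; apply: H; exists c%:R => q [n [k ->]].
rewrite Y0/= leNgt; apply/negP => cY; apply: NE; exists n => //; exists k => //=.
exact: ltW.
Qed.

(** The events [E c n] ask for more than [c] upcrossings on all grids from level [n] on. Taking
    tails makes them increase with [n] without comparing the counts of different grids, and explains
    why the conclusion speaks of infinitely many levels. *)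
Lemma few_upcrossings_ae (a b : rat) (K : nat) : 0 < a -> a < b ->
  \forall w \ae Pr, exists m : nat, forall n0 : nat, exists2 n, (n0 <= n)%N &
    (upcrossings (ratr a) (ratr b) (fun k => Y (grid n k) w) (K * 2 ^ n) <= m)%N.
Proof.
move=> a0 ab.
have a0' : 0 <= ratr a :> R by rewrite ler0q ltW.
have ab' : ratr a < ratr b :> R by rewrite ltr_rat.
pose U n w : R :=
  (upcrossings (ratr a) (ratr b) (fun k => Y (grid n k) w) (K * 2 ^ n))%:R.
have mU n : measurable_fun setT (U n).
  exact: (measurable_upcrossings (sG n) (@Gm n) (@GG n) (myG n)).
have mS (c n : nat) : measurable [set w | c%:R < U n w].
  rewrite (_ : mkset _ = setT `&` U n @^-1` `]c%:R, +oo[).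
    by apply: mU => //; exact: measurable_itv.
  by apply/seteqP; split => w /=; rewrite in_itv/= andbT => // -[].
pose E (c n : nat) := \bigcap_(j in [set j | (n <= j)%N]) [set w | c%:R < U j w].
have mE c n : measurable (E c n) by apply: bigcap_measurable => //; exists n => /=.
have ndE c : nondecreasing_seq (E c).
  move=> n n' nn'; apply/subsetPset => w Ew j /= n'j.
  by apply: Ew => /=; exact: leq_trans n'j.
have EC c n : (c%:R%:E * Pr (E c n) <= (ratr a / (ratr b - ratr a))%:E)%E.
  have cU : (c%:R%:E * Pr (E c n) <= \int[Pr]_w (U n w)%:E)%E.
    rewrite -integral_cst//.
    apply: (@le_trans _ _ (\int[Pr]_(w in E c n) (U n w)%:E)%E).
      apply: ge0_le_integral => //.
      - by move=> w _; rewrite lee_fin.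
      - exact/measurable_funTS/measurable_EFinP.
      - by move=> w Ew; rewrite lee_fin ltW//; exact: (Ew n (leqnn n)).
    apply: ge0_subset_integral => //; first exact/measurable_EFinP.
    by move=> w _; rewrite lee_fin.
  have UI := @upcrossing_ineq _ _ _ Pr (fun k => F (grid n k)) xi
    (fun k => Y (grid n k)) (sG n) (@Gm n) (@GG n) (myG n)
    (fun k w => Y0 _ w) (@YGE n) _ _ a0' ab' (K * 2 ^ n)%N.
  have ba0 : 0 < ratr b - ratr a :> R by rewrite subr_gt0.
  have fE : Pr (E c n) \is a fin_num by exact: fin_num_measure.
  have := le_trans (lee_wpmul2l _ cU) UI.
  rewrite lee_fin -(fineK fE) -!EFinM !lee_fin => /(_ (ltW ba0)).
  by move=> H; rewrite ler_pdivlMr//; apply: le_trans H; rewrite mulrC.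
apply: negligibleS (negligible_tail mE ndE EC) => w H c _.
apply: contrapT => NE; apply: H; exists c => n0; apply: contrapT => H.
apply: NE; exists n0 => // j /= nj; rewrite /U ltr_nat ltnNge; apply/negP => Uc.
by apply: H; exists j.
Qed.

Lemma regular_path_ae : \forall w \ae Pr, regular_path (Y ^~ w).
Proof.
(* Numbering the triples [(a, b, K)] by [pickle] turns the quantification over them into a countable
   intersection. *)
have few : \forall w \ae Pr, forall (i : nat),
    if unpickle i is Some (a, b, K) then (0 < a :> rat) -> a < b :> rat ->
      exists m : nat, forall n0 : nat, exists2 n, (n0 <= n)%N &
      (upcrossings (ratr a) (ratr b) (fun k => Y (grid n k) w) (K * 2 ^ n) <= m)%N
    else True.
  apply: ae_foralln => i; case: unpickle => [[[a b] K]|]; last exact: nearW.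
  have [a0|a0] := boolP (0 < a); last exact: nearW.
  have [ab|ab] := boolP (a < b); last exact: nearW.
  by apply: filterS (few_upcrossings_ae K a0 ab) => w.
apply: filterS2 bounded_path_ae few => w bw fw; split => // a b K a0 ab.
by have := fw (pickle (a, b, K)); rewrite pickleK; apply.
Qed.

(** The value 0 on irregular paths and at negative times makes every path cadlag, not just almost
    every one. *)
Definition cadlag_version (t : R) (w : Omega) : R :=
  if `[< regular_path (Y ^~ w) /\ 0 <= t >]
  then xget 0 [set l | dyadic_limit (Y ^~ w) (dyadic_right t) l] else 0.

Local Notation Z := cadlag_version.

Lemma cadlag_version_limit t w : regular_path (Y ^~ w) -> 0 <= t ->
  dyadic_limit (Y ^~ w) (dyadic_right t) (Z t w).
Proof.
move=> rw t0; rewrite /cadlag_version asboolT//.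
have [[C YC] few] := rw.
have [l Yl] := dyadic_right_limit YC few t0.
exact: (@xgetPex _ 0 [set l | dyadic_limit (Y ^~ w) (dyadic_right t) l] (ex_intro _ l Yl)).
Qed.

Lemma cadlag_version_bad t w : ~ regular_path (Y ^~ w) -> Z t w = 0.
Proof. by move=> nr; rewrite /cadlag_version asboolF// => -[]. Qed.

Lemma cadlag_version_ge0 t w : 0 <= Z t w.
Proof.
have [[rw t0]|H] := pselect (regular_path (Y ^~ w) /\ 0 <= t); last first.
  by rewrite /cadlag_version asboolF.
rewrite leNgt; apply/negP => Z0.
have [|e e0 H] := cadlag_version_limit rw t0 (e := - Z t w / 2).
  by rewrite divr_gt0// oppr_gt0.
have [|q dq tq] := @dyadic_between R t (t + e) t0; first by rewrite ltrDl.
have := H q (conj dq tq); have := Y0 q w; rewrite ler_norml => Yq /andP[_].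
by move: (Y q w) Yq Z0 => y; lra.
Qed.

Lemma cadlag_version_cadlag : cadlag Z.
Proof.
move=> w; have [rw|nr] := pselect (regular_path (Y ^~ w)); last first.
  have -> : Z ^~ w = cst 0 by apply/funext => s; rewrite cadlag_version_bad.
  by split => t t0; [rewrite cadlag_version_bad//; exact: cvg_cst|exact: is_cvg_cst].
(* [Z s] is itself a limit of dyadic values just to the right of [s]. *)
have near_Z s u v l e : 0 <= s -> u <= s < v ->
    (forall q, dyadic q -> u < q < v -> `|Y q w - l| <= e) -> `|Z s w - l| <= e.
  move=> s0 /andP[us sv] H; apply/ler_addgt0Pr => e' e'0.
  have [del del0 Hs] := cadlag_version_limit rw s0 e'0.
  have [|q dq /andP[sq]] := @dyadic_between R s (Num.min v (s + del)) s0.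
    by rewrite lt_min sv ltrDl.
  rewrite lt_min => /andP[qv qs].
  have := Hs q (conj dq _); rewrite sq qs distrC => /(_ isT) h1.
  have := H q dq; rewrite (le_lt_trans us sq) qv => /(_ isT) h2.
  rewrite (le_trans (ler_distD (Y q w) _ _))// addrC lerD//.
split => t t0.
  apply/cvgrPdist_le => e e0.
  have [del del0 H] := cadlag_version_limit rw t0 e0.
  near=> s; rewrite distrC; apply: (@near_Z s t (t + del)).
  - by rewrite (le_trans t0)// ltW//; near: s; exact: nbhs_right_gt.
  - apply/andP; split; first by near: s; exact: nbhs_right_ge.
    by near: s; apply: nbhs_right_lt; rewrite ltrDl.
  - by move=> q dq tq; apply: H.
have [[C YC] few] := rw.
have [l Yl] := dyadic_left_limit YC few t0.
apply/cvg_ex; exists l; apply/cvgrPdist_le => e e0.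
have [del del0 H] := Yl e e0.
near=> s; rewrite distrC; apply: (@near_Z s (t - del) t).
- by near: s; apply: nbhs_left_ge.
- apply/andP; split; last by near: s; exact: nbhs_left_lt.
  by near: s; apply: nbhs_left_ge; rewrite ltrBlDr ltrDl.
- by move=> q dq tq; apply: H.
Unshelve. all: by end_near. Qed.

End CadlagVersion.

Lemma cvg_minr_cst {R : realType} (u : nat -> R) (l c : R) :
  u n @[n --> \oo] --> l -> Num.min (u n) c @[n --> \oo] --> Num.min l c.
Proof.
move=> ul; rewrite minr_absE; under eq_fun do rewrite minr_absE.
apply: cvgMr_tmp; apply: cvgB; first by apply: cvgD => //; exact: cvg_cst.
by apply: cvg_norm; apply: cvgB => //; exact: cvg_cst.
Qed.

Lemma cvg_maxr_cst {R : realType} (u : nat -> R) (l c : R) :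
  u n @[n --> \oo] --> l -> Num.max (u n) c @[n --> \oo] --> Num.max l c.
Proof.
move=> ul; rewrite maxr_absE; under eq_fun do rewrite maxr_absE.
apply: cvgMr_tmp; apply: cvgD; first by apply: cvgD => //; exact: cvg_cst.
by apply: cvg_norm; apply: cvgB => //; exact: cvg_cst.
Qed.

Section CadlagVersionMartingale.
Context {R : realType} {d : measure_display} {Omega : measurableType d}.
Variable Pr : probability Omega R.
Variable F : R -> set (set Omega).
Hypothesis fF : filtration F.
Hypothesis uF : usual_conditions Pr F.
Variable xi : Omega -> R.
Hypothesis mxi : measurable_fun setT xi.
Hypothesis xi0 : forall w, 0 <= xi w.
Hypothesis ixi : Pr.-integrable setT (EFin \o xi).
Variable Y : R -> Omega -> R.
Hypothesis Y0 : forall s w, 0 <= Y s w.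
Hypothesis mY : forall s, 0 <= s -> measurable_wrt (F s) (Y s).
Hypothesis YE : forall s A, 0 <= s -> F s A ->
  (\int[Pr]_(w in A) (Y s w)%:E = \int[Pr]_(w in A) (xi w)%:E)%E.

Let sF t : 0 <= t -> sigma_algebra setT (F t). Proof. by case: fF => + _ _; exact. Qed.
Let Fm t : 0 <= t -> F t `<=` measurable. Proof. by case: fF => _ + _; exact. Qed.
Let FF s t : 0 <= s -> s <= t -> F s `<=` F t. Proof. by case: fF => _ _; exact. Qed.

Local Notation Z := (cadlag_version Y).
Let q (t : R) n : R := grid n (next_index n t).

Let q_ge0 t n : 0 <= q t n. Proof. exact: grid_ge0. Qed.

Let regular_ae : \forall w \ae Pr, regular_path (Y ^~ w).
Proof. exact: (regular_path_ae fF mxi xi0 ixi Y0 mY YE). Qed.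

Lemma cadlag_version_cvg t w : regular_path (Y ^~ w) -> 0 <= t ->
  Y (q t n) w @[n --> \oo] --> Z t w.
Proof.
move=> rw t0; apply/cvgrPdist_le => e e0.
have [del del0 H] := cadlag_version_limit rw t0 e0.
have [N Ndel] := invexpr2_lt del0.
exists N => // n /= Nn; rewrite distrC; apply: H; split; first by exists n, (next_index n t).
rewrite next_index_gt (le_lt_trans (next_index_le _ t0))// ltrD2l.
by rewrite (le_lt_trans _ Ndel)// lef_pV2 ?posrE ?exprn_gt0// ler_eXn2l// ltr1n.
Qed.

(** For each u > t, [Z t] is a limit of values of [Y] at grid points between [t] and [u], corrected
    on a null set, hence [F u]-measurable; right-continuity of the filtration brings [u] down to
    [t]. *)
Lemma cadlag_version_adapted : adapted F Z.
Proof.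
move=> t t0; apply: (measurable_wrt_right uF t0) => u tu.
have u0 : 0 <= u by rewrite (le_trans t0)// ltW.
have [|N Nu] := @invexpr2_lt R (u - t); first by rewrite subr_gt0.
(* The shift by [N] keeps every grid point used below [u]. *)
pose X n w := if `[< regular_path (Y ^~ w) >] then Y (q t (n + N)) w else 0.
apply: (@measurable_wrt_cvg _ _ _ _ X) => //; first exact: sF.
- move=> n; apply: (@measurable_wrt_ae _ _ _ Pr F fF uF u (Y (q t (n + N)))) => //.
    by apply: filterS regular_ae => w rw; rewrite /X asboolT.
  apply: measurable_wrt_sub (mY (q_ge0 _ _)); apply: FF => //.
  rewrite (le_trans (next_index_le _ t0))// -lerBrDl (le_trans _ (ltW Nu))//.
  by rewrite lef_pV2 ?posrE ?exprn_gt0// ler_eXn2l ?ltr1n// leq_addl.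
- move=> w; rewrite /X; have [rw|nr] := pselect (regular_path (Y ^~ w)).
    rewrite asboolT//.
    have := cadlag_version_cvg rw t0.
    by rewrite -(cvg_shiftn N).
  by rewrite asboolF// cadlag_version_bad//; exact: cvg_cst.
Qed.

Let mZ t : 0 <= t -> measurable_fun setT (Z t).
Proof.
by move=> t0; exact: measurable_wrt_measurable (Fm t0) (cadlag_version_adapted t0).
Qed.

Let mYT t : 0 <= t -> measurable_fun setT (Y t).
Proof. by move=> t0; exact: measurable_wrt_measurable (Fm t0) (mY t0). Qed.

Lemma excess_small e : 0 < e -> exists n : nat, (excess Pr xi n%:R <= e%:E)%E.
Proof.
move=> e0; have := excess_cvg mxi xi0 ixi.
move=> /fine_cvgP[[N1 _ fin] /cvgrPdist_le /(_ e e0)[N2 _ H]].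
exists (maxn N1 N2).
have f1 := fin _ (leq_maxl N1 N2); have := H _ (leq_maxr N1 N2).
rewrite /= sub0r normrN -(fineK f1) lee_fin; apply: le_trans.
exact: ler_norm.
Qed.

(** Fatou gives one inequality. For the other, [Y] is split into its minimum with [m] and its excess
    over [m]: the first part converges by domination, and the second is at most [e] in mean for
    every [n], by comparison with [xi]. *)
Lemma integral_cadlag_version t A : 0 <= t -> F t A ->
  (\int[Pr]_(w in A) (Z t w)%:E = \int[Pr]_(w in A) (xi w)%:E)%E.
Proof.
move=> t0 FA; have mA := Fm t0 FA.
have tq n : t <= q t n by rewrite ltW// next_index_gt.
have FqA n : F (q t n) A by exact: FF (tq n) _ FA.
have Z0 := @cadlag_version_ge0 _ _ _ _ Y0.
have cY : \forall w \ae Pr, Y (q t n) w @[n --> \oo] --> Z t w.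
  by apply: filterS regular_ae => w rw; exact: cadlag_version_cvg.
apply/eqP; rewrite eq_le; apply/andP; split.
  apply: (@fatou_bound _ _ _ Pr A (fun n => Y (q t n))) => //.
  - by move=> n; exact: mYT.
  - exact: mZ.
  - by move=> n; rewrite YE.
apply/lee_addgt0Pr => e e0; have [m me] := excess_small e0.
have cmin : (\int[Pr]_(w in A) (Num.min (Y (q t n) w) m%:R)%:E)%E @[n --> \oo] -->
    (\int[Pr]_(w in A) (Num.min (Z t w) m%:R)%:E)%E.
  have [||||| _ _ //] := @dominated_convergence _ _ _ Pr A mA
    (fun n w => (Num.min (Y (q t n) w) m%:R)%:E)
    (fun w => (Num.min (Z t w) m%:R)%:E) (cst m%:R%:E).
  - move=> n; apply/measurable_funTS/measurable_EFinP/measurable_minr => //.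
    exact: mYT.
  - apply/measurable_funTS/measurable_EFinP/measurable_minr => //.
    exact: mZ.
  - apply: filterS cY => w cw _; apply: cvg_EFin; first exact: nearW.
    exact: cvg_minr_cst.
  - exact: finite_measure_integrable_cst.
  - apply: aeW => w n _; rewrite lee_fin ger0_norm ?ge_min ?lexx ?orbT//.
    by rewrite le_min Y0 ler0n.
have minZ : (\int[Pr]_(w in A) (Num.min (Z t w) m%:R)%:E <= \int[Pr]_(w in A) (Z t w)%:E)%E.
  apply: ge0_le_integral => //.
  - by move=> w _; rewrite lee_fin le_min Z0 ler0n.
  - by apply/measurable_funTS/measurable_EFinP/measurable_minr => //; exact: mZ.
  - by apply/measurable_funTS/measurable_EFinP; exact: mZ.
  - by move=> w _; rewrite lee_fin ge_min lexx.
apply: le_trans (leeD minZ (le_refl e%:E)).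
rewrite -leeBlDr//.
apply: (cvge_to_ge cmin); apply: nearW => n.
rewrite leeBlDr//.
have exY : (excess Pr (Y (q t n)) m%:R <= e%:E)%E.
  apply: le_trans me; apply: excess_le => //; first exact: mYT.
  by rewrite YE//; apply: measurable_wrt_gt; exact: mY.
rewrite -(YE (q_ge0 t n) (FqA n)).
have -> : (\int[Pr]_(w in A) (Y (q t n) w)%:E =
  \int[Pr]_(w in A) (Num.min (Y (q t n) w) m%:R)%:E +
  \int[Pr]_(w in A) (Num.max (Y (q t n) w - m%:R) 0)%:E)%E.
  rewrite -ge0_integralD//.
  - apply: eq_integral => w _; rewrite -EFinD; congr (_%:E).
    by rewrite /Num.min /Num.max; case: ifPn; case: ifPn; rewrite ?subr_lt0 -?leNgt; lra.
  - by move=> w _; rewrite lee_fin le_min Y0 ler0n.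
  - by apply/measurable_funTS/measurable_EFinP/measurable_minr => //; exact: mYT.
  - by move=> w _; rewrite lee_fin le_max lexx orbT.
  - by apply/measurable_funTS/measurable_excess; exact: mYT.
apply: leeD => //; apply: le_trans exY.
apply: ge0_subset_integral => //; first by apply: measurable_excess; exact: mYT.
by move=> w _; rewrite lee_fin le_max lexx orbT.
Qed.

End CadlagVersionMartingale.

(** * Martingales sampled at stopping times *)

Section SampledMartingale.
Context {R : realType} {d : measure_display} {Omega : measurableType d}.
Variable Pr : probability Omega R.
Variable F : R -> set (set Omega).
Hypothesis fF : filtration F.
Variables (xi : Omega -> R) (Z : R -> Omega -> R).
Hypothesis mxi : measurable_fun setT xi.
Hypothesis xi0 : forall w, 0 <= xi w.
Hypothesis adZ : adapted F Z.
Hypothesis cZ : cadlag Z.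
Hypothesis Z0 : forall t w, 0 <= Z t w.
Hypothesis ZE : forall t A, 0 <= t -> F t A ->
  (\int[Pr]_(w in A) (Z t w)%:E = \int[Pr]_(w in A) (xi w)%:E)%E.

Let sF t : 0 <= t -> sigma_algebra setT (F t). Proof. by case: fF => + _ _; exact. Qed.
Let Fm t : 0 <= t -> F t `<=` measurable. Proof. by case: fF => _ + _; exact. Qed.
Let FF s t : 0 <= s -> s <= t -> F s `<=` F t. Proof. by case: fF => _ _; exact. Qed.

Variable tau : Omega -> R.
Hypothesis stau : stopping_time F (EFin \o tau).

Let tau_ge0 w : 0 <= tau w. Proof. by case: stau => /(_ w); rewrite /= lee_fin. Qed.
Let tau_le t : 0 <= t -> F t [set w | tau w <= t].
Proof. by case: stau => _ /[apply]. Qed.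

Lemma stopping_time_lt t : 0 <= t -> F t [set w | tau w < t].
Proof.
move=> t0; have sT := measurable_g_measurableTypeE (sF t0).
have -> : [set w | tau w < t] = \bigcup_n [set w | tau w <= t - n.+1%:R^-1].
  apply/seteqP; split => w /=.
    rewrite -subr_gt0 => tw; exists (Num.truncn (t - tau w)^-1) => //=.
    rewrite lerBrDl -lerBrDr invf_ple ?posrE// ltW// truncnS_gt//.
  by move=> [n _ /= h]; rewrite (le_lt_trans h)// ltrBlDr ltrDl invr_gt0.
rewrite -sT; apply: bigcup_measurable => n _; rewrite sT.
(* [F] is constrained at non-negative times only; below a negative bound the event is empty. *)
have [h|h] := leP 0 (t - n.+1%:R^-1).
  by apply: (FF h); [rewrite lerBlDr lerDl invr_ge0|exact: tau_le].
rewrite (_ : mkset _ = set0).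
  by case: (sF t0).
by apply/seteqP; split => w //=; apply/negP; rewrite -ltNge (lt_le_trans h).
Qed.

Let k n w := next_index n (tau w).

(** Rounding up strictly gives index [j.+1] exactly when tau lies in [grid n j, grid n j.+1), hence
    the events with strict inequality. Index 0 never occurs. *)
Let Gk n j : F (grid n j) [set w | k n w = j].
Proof.
have sT := measurable_g_measurableTypeE (sF (grid_ge0 n j)).
case: j sT => [|j] sT.
  rewrite (_ : mkset _ = set0); first by case: (sF (grid_ge0 n 0)).
  by apply/seteqP; split => w.
have -> : [set w | k n w = j.+1] =
    [set w | tau w < grid n j.+1] `\` [set w | tau w < grid n j].
  have twoX : 0 < 2 ^+ n :> R by rewrite exprn_gt0.
  apply/seteqP; split => w /=.
    move=> kw; split; first by rewrite -kw; exact: next_index_gt.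
    move: kw => [kw]; apply/negP; rewrite -leNgt /grid -kw ler_pdivrMr//.
    by rewrite truncn_le mulr_ge0// ltW.
  move=> [h1 /negP]; rewrite -leNgt => h2; congr (_.+1).
  apply: truncn_def; move: h1 h2; rewrite /grid ltr_pdivlMr// ler_pdivrMr//.
  by move=> -> ->.
rewrite -sT; apply: measurableD; rewrite sT; first exact/stopping_time_lt/grid_ge0.
apply: (FF (grid_ge0 n j)); first by rewrite grid_le.
exact/stopping_time_lt/grid_ge0.
Qed.

Let Zn n w := Z (grid n (k n w)) w.

Let mZn n : measurable_fun setT (Zn n).
Proof.
apply: (@measurable_sampled _ _ _ (fun j => F (grid n j)) (fun j => Z (grid n j))).
- by move=> j; exact/sF/grid_ge0.
- by move=> j; exact/Fm/grid_ge0.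
- by move=> j; exact/adZ/grid_ge0.
- exact: Gk.
Qed.

Let cZn w : Zn n w @[n --> \oo] --> Z (tau w) w.
Proof.
have [cr _] := cZ w; have := cr _ (tau_ge0 w).
move=> /cvgrPdist_le H; apply/cvgrPdist_le => e e0.
have [del /= del0 {}H] := H e e0.
have [N Ndel] := invexpr2_lt del0.
exists N => // n /= Nn; apply: H; last exact: next_index_gt.
rewrite /ball_/= ltr0_norm; last by rewrite subr_lt0 next_index_gt.
rewrite opprB ltrBlDr addrC (le_lt_trans (next_index_le _ _))// ltrD2l.
by rewrite (le_lt_trans _ Ndel)// lef_pV2 ?posrE ?exprn_gt0// ler_eXn2l// ltr1n.
Qed.

Lemma measurable_stopped : measurable_fun setT (fun w => Z (tau w) w).
Proof. by apply: (@measurable_fun_cvg _ _ _ setT Zn) => // w _; exact: cZn. Qed.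

Lemma excess_stopped m : 0 <= m ->
  (excess Pr (fun w => Z (tau w) w) m <= excess Pr xi m)%E.
Proof.
move=> m0.
apply: (@fatou_bound _ _ _ Pr setT (fun n w => Num.max (Zn n w - m) 0)) => //.
- by move=> n; apply: measurable_maxr => //; exact: measurable_funB.
- by move=> n w; rewrite le_max lexx orbT.
- by apply: measurable_maxr => //; apply: measurable_funB => //; exact: measurable_stopped.
- by move=> w; rewrite le_max lexx orbT.
- apply: aeW => w; apply: cvg_maxr_cst.
  by apply: cvgB; [exact: cZn|exact: cvg_cst].
- move=> n; apply: (@excess_sampled _ _ _ Pr (fun j => F (grid n j)) xi
    (fun j => Z (grid n j))) => //.
  + by move=> j; exact/sF/grid_ge0.
  + by move=> j; exact/Fm/grid_ge0.
  + by move=> j; exact/adZ/grid_ge0.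
  + by move=> j A; exact/ZE/grid_ge0.
Qed.

End SampledMartingale.

(** * The smoothing function and uniform integrability *)

Section PhiFacts.
Context {R : realType}.
Implicit Types x : R.

(* Valid at [x = 0] too, because [ln 0 = 0] here. *)
Lemma PhiE x : Phi x = ln `|expR x - 1| - ln `|x|.
Proof.
rewrite /Phi /Psi; case: eqVneq => [->|x0].
  by rewrite mul0r expR0 subrr !normr0 subrr.
rewrite mulrA divff// mul1r -ln_div ?posrE ?normr_gt0 ?subr_eq0//.
  rewrite -normf_div gtr0_norm//; move: x0; rewrite neq_lt => /orP[x0|x0].
    by rewrite nmulr_lgt0 ?invr_lt0// subr_lt0 expR_lt1.
  by rewrite divr_gt0// subr_gt0 expR_gt1.
by apply: contra x0 => /eqP; rewrite -{1}expR0 => /expR_inj ->.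
Qed.

Lemma measurable_Phi : measurable_fun setT (@Phi R).
Proof.
have -> : @Phi R = fun x => ln `|expR x - 1| - ln `|x| by apply/funext/PhiE.
apply: measurable_funB; apply: measurableT_comp => //; apply: measurableT_comp => //.
exact: measurable_funB.
Qed.

(** For nonzero x, [Phi x] is the logarithm of (e^x - 1) / x, and x <= e^x - 1 <= x e^x places this
    quotient between 1 and e^x, so [Phi x] lies between 0 and x. *)
Lemma normr_Phi_le x : `|Phi x| <= `|x|.
Proof.
have [->|x0] := eqVneq x 0; first by rewrite /Phi mul0r.
have h1 : x <= expR x - 1 by rewrite lerBrDl expR_ge1Dx.
have h2 : expR x - 1 <= x * expR x.
  have := expR_ge1Dx (- x); rewrite expRN => h.
  have := ler_wpM2r (ltW (expR_gt0 x)) h.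
  rewrite mulVf ?gt_eqF ?expR_gt0//; lra.
rewrite PhiE; move: x0; rewrite neq_lt => /orP[x0|x0].
  have e1 : 0 < 1 - expR x by rewrite subr_gt0 expR_lt1.
  have e2 : expR x - 1 < 0 by rewrite -opprB oppr_lt0.
  rewrite (ltr0_norm e2) (ltr0_norm x0).
  have p1 : - (expR x - 1) \is Num.pos by rewrite posrE opprB.
  have p2 : - x \is Num.pos by rewrite posrE oppr_gt0.
  have p3 : expR x \is Num.pos by rewrite posrE expR_gt0.
  have p4 : - x * expR x \is Num.pos by rewrite posrE mulr_gt0 ?oppr_gt0 ?expR_gt0.
  have l1 : ln (- (expR x - 1)) <= ln (- x) by rewrite ler_ln// lerN2.
  have l2 : ln (- x) + x <= ln (- (expR x - 1)).
    by rewrite -{2}[x]expRK -lnM// ler_ln// mulNr lerN2.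
  by rewrite ler_norml; apply/andP; split; lra.
have e1 : 0 < expR x - 1 by rewrite subr_gt0 expR_gt1.
rewrite (gtr0_norm e1) (gtr0_norm x0).
have l1 : ln x <= ln (expR x - 1) by rewrite ler_ln ?posrE.
have l2 : ln (expR x - 1) <= ln x + x.
  rewrite -{3}[x]expRK -lnM ?posrE ?expR_gt0// ler_ln ?posrE//.
  by rewrite mulr_gt0 ?expR_gt0.
by rewrite ler_norml; apply/andP; split; lra.
Qed.

End PhiFacts.

Section UniformIntegrability.
Context {R : realType} {d : measure_display} {Omega : measurableType d}.
Variable Pr : probability Omega R.

(* If [|X| <= X1 + X2 + X3] with each [X_i] below [xi_i] in the increasing convex
   order, then [|X| > 2 (m1 + m2 + m3)] forces [|X| <= 2 (|X| - m1 - m2 - m3)]. *)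
Lemma uniformly_integrable_excess (H : set (Omega -> R)) (xi : 'I_3 -> Omega -> R) :
  (forall i, measurable_fun setT (xi i)) -> (forall i w, 0 <= xi i w) ->
  (forall i, Pr.-integrable setT (EFin \o xi i)) ->
  (forall X, H X -> measurable_fun setT X) ->
  (forall X, H X -> exists Xs : 'I_3 -> Omega -> R,
    [/\ (forall i, measurable_fun setT (Xs i)),
        (forall w, `|X w| <= \sum_(i < 3) Xs i w) &
        (forall i m, 0 <= m -> (excess Pr (Xs i) m <= excess Pr (xi i) m)%E)]) ->
  uniformly_integrable Pr H.
Proof.
move=> mxi xi0 ixi mH dom; split => // eps eps0.
(* Six is three excesses times the factor 2. *)
have eps6 : 0 < eps / 6 by rewrite divr_gt0.
have [m mE] : exists m : 'I_3 -> nat,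
    forall i, (excess Pr (xi i) (m i)%:R <= (eps / 6)%:E)%E.
  have ex i := excess_small (mxi i) (xi0 i) (ixi i) eps6.
  by exists (fun i => sval (cid (ex i))) => i; case: cid.
pose S : R := \sum_(i < 3) (m i)%:R.
have S0 : 0 <= S by apply: sumr_ge0.
exists (2 * S) => X HX; have mX := mH X HX.
have [Xs [mXs XXs exX]] := dom X HX.
set B := [set w | _].
have mB : measurable B.
  rewrite (_ : B = setT `&` (fun w => `|X w|) @^-1` `]2 * S, +oo[).
    by apply: (measurableT_comp (@normr_measurable R setT) mX) => //; exact: measurable_itv.
  by apply/seteqP; split => w /=; rewrite /B /= in_itv/= andbT => // -[].
pose g i w := (Num.max (Xs i w - (m i)%:R) 0)%:E.
have g0 i w : (0 <= g i w)%E by rewrite lee_fin le_max lexx orbT.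
have mg i : measurable_fun setT (g i) by exact: measurable_excess.
apply: (@le_trans _ _ (\int[Pr]_(w in B) (2%:E * \sum_(i < 3) g i w))%E).
  apply: ge0_le_integral => //.
  - exact/measurable_funTS/measurable_EFinP/measurableT_comp.
  - apply: measurable_funTS; apply: emeasurable_funM => //.
    by apply: emeasurable_sum.
  - move=> w; rewrite /B/= => Bw; rewrite sumEFin -EFinM lee_fin.
    have h : \sum_(i < 3) (Xs i w - (m i)%:R) <= \sum_(i < 3) Num.max (Xs i w - (m i)%:R) 0.
      by apply: ler_sum => i _; rewrite le_max lexx.
    rewrite sumrB in h; have := XXs w; move: h Bw; rewrite -/S.
    move: (\sum_(i < 3) Xs i w) (\sum_(i < 3) Num.max _ _) => u v; lra.
apply: (@le_trans _ _ (\int[Pr]_w (2%:E * \sum_(i < 3) g i w))%E).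
  apply: ge0_subset_integral => //.
    by apply: emeasurable_funM => //; exact: emeasurable_sum.
  by move=> w _; apply: mule_ge0 => //; exact: sume_ge0.
rewrite ge0_integralZl//; last 2 first.
- by apply: emeasurable_sum.
- by move=> w _; exact: sume_ge0.
rewrite ge0_integral_sum//.
have : (\sum_(i < 3) \int[Pr]_w g i w <= \sum_(i < 3) (eps / 6)%:E)%E.
  apply: lee_sum => i _; apply: le_trans (mE i).
  exact: exX.
rewrite sumEFin sumr_const card_ord => h.
have := lee_wpmul2l (_ : (0 <= 2%:E)%E) h; rewrite lee_fin => /(_ (ler0n _ 2)).
by move=> /le_trans; apply; rewrite lee_fin mulr_natl; lra.
Qed.

(** The majorants in later uses are [xi^\+], [xi^\-] and one fixed variable: [|Z 0|] for the
    martingale, the sum of the [|g i|] for the value process. *)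
Lemma uniformly_integrable_excess3 (H : set (Omega -> R)) (x1 x2 x3 : Omega -> R) :
  (forall x, x \in [:: x1; x2; x3] -> [/\ measurable_fun setT x,
     (forall w, 0 <= x w) & Pr.-integrable setT (EFin \o x)]) ->
  (forall X, H X -> measurable_fun setT X /\ exists X1 X2 X3 : Omega -> R,
    [/\ [/\ measurable_fun setT X1, measurable_fun setT X2 & measurable_fun setT X3],
        (forall w, `|X w| <= X1 w + X2 w + X3 w) &
        forall m, 0 <= m -> [/\ (excess Pr X1 m <= excess Pr x1 m)%E,
          (excess Pr X2 m <= excess Pr x2 m)%E &
          (excess Pr X3 m <= excess Pr x3 m)%E]]) ->
  uniformly_integrable Pr H.
Proof.
move=> Hx dom; pose f (y1 y2 y3 : Omega -> R) (i : 'I_3) := nth y1 [:: y1; y2; y3] i.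
have fx i : f x1 x2 x3 i \in [:: x1; x2; x3] by apply: mem_nth.
apply: (@uniformly_integrable_excess H (f x1 x2 x3)).
- by move=> i; have [] := Hx _ (fx i).
- by move=> i; have [] := Hx _ (fx i).
- by move=> i; have [] := Hx _ (fx i).
- by move=> X /dom[].
- move=> X /dom[_ [X1 [X2 [X3 [[m1 m2 m3] XX ex]]]]].
  exists (f X1 X2 X3); split.
  + by move=> [[|[|[|]]]].
  + by move=> w; rewrite !big_ord_recl big_ord0 addr0 addrA; exact: XX.
  + by move=> [[|[|[|//]]]] ? m /ex[].
Qed.

End UniformIntegrability.

(** * Optional processes *)

Section OptionalProcesses.
Context {R : realType} {d : measure_display} {Omega : measurableType d}.
Variable F : R -> set (set Omega).
Hypothesis fF : filtration F.
Implicit Types X : R -> Omega -> R.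

Let sF t : 0 <= t -> sigma_algebra setT (F t). Proof. by case: fF => + _ _; exact. Qed.
Let FF s t : 0 <= s -> s <= t -> F s `<=` F t. Proof. by case: fF => _ _; exact. Qed.

Let D := [set z : R * Omega | 0 <= z.1].

(* The library only has measurable types whose sigma-algebras live on [setT];
   [optional_sets] is the one whose trace on [D] is the optional sigma-algebra. *)
Definition optional_sets : set (set (R * Omega)) :=
  [set E | optional_sigma_algebra F (D `&` E)].

Lemma optional_sigma_algebraP : sigma_algebra D (optional_sigma_algebra F).
Proof. exact: smallest_sigma_algebra. Qed.

Lemma sigma_algebra_optional_sets : sigma_algebra setT optional_sets.
Proof.
have [E0 EC EU] := optional_sigma_algebraP; split.
- by rewrite /optional_sets/= setI0.
- move=> A OA; rewrite /optional_sets/= setTD.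
  rewrite (_ : D `&` ~` A = D `\` (D `&` A)); first exact: EC.
  apply/seteqP; split => z /= [Dz nA]; split => //; first by move=> [].
  by move=> Az; apply: nA.
- by move=> A OA; rewrite /optional_sets/= setI_bigcupr; exact: EU.
Qed.

Lemma optionalP X : optional F X <->
  measurable_fun setT ((fun z => X z.1 z.2) : g_sigma_algebraType optional_sets -> R).
Proof.
have sO := measurable_g_measurableTypeE sigma_algebra_optional_sets.
split => [oX _ B mB|mX B mB].
  by rewrite setTI sO; exact: oX.
by have := mX measurableT B mB; rewrite setTI sO.
Qed.

Lemma cadlag_optional X : adapted F X -> cadlag X -> optional F X.
Proof.
by move=> aX cX B mB; apply: sub_sigma_algebra; exists X; split => //; exists B.
Qed.

Lemma optionalD X X' : optional F X -> optional F X' ->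
  optional F (fun t w => X t w + X' t w).
Proof.
by move=> /optionalP oX /optionalP oX'; apply/optionalP; exact: measurable_funD.
Qed.

Lemma optionalN X : optional F X -> optional F (fun t w => - X t w).
Proof.
by move=> /optionalP oX; apply/optionalP; exact: measurable_funN.
Qed.

Lemma optional_sum (I : Type) (r : seq I) (X : I -> R -> Omega -> R) :
  (forall i, optional F (X i)) -> optional F (fun t w => \sum_(i <- r) X i t w).
Proof.
move=> oX; apply/optionalP; apply: measurable_sum => i.
exact/optionalP.
Qed.

(** The sets whose section at every s >= 0 belongs to [F s] form a sigma-algebra on [D] that
    contains the generators. *)
Lemma optional_adapted X : optional F X -> adapted F X.
Proof.
move=> oX t t0 B mB.
pose H : set (set (R * Omega)) :=
  [set E | forall s, 0 <= s -> F s [set w | E (s, w)]].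
have sH : sigma_algebra D H.
  split.
  - by move=> s s0; have [+ _ _] := sF s0; congr (F s); apply/seteqP; split.
  - move=> E HE s s0; have [_ /(_ _ (HE s s0)) + _] := sF s0.
    congr (F s _); apply/seteqP; split => w /= []; first by move=> _ nE; split.
    by move=> _ nE; split.
  - move=> E HE s s0.
    rewrite (_ : mkset _ = \bigcup_k [set w | E k (s, w)]).
      by have [_ _] := sF s0; apply=> n; exact: HE.
    by apply/seteqP; split => w [k _ ?]; exists k.
have OH : optional_sigma_algebra F `<=` H.
  apply: smallest_sub => // E [X' [aX' cX' [C mC ->]]] s s0.
  have := aX' s s0 C mC; congr (F s); apply/seteqP; split => w /=.
    by split.
  by move=> [].
have := OH _ (oX B mB) t t0; congr (F t); apply/seteqP; split => w /=.
  by move=> [].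
by split.
Qed.

(** Still 0 at [u] and switched on just after, this step matches the condition s <= t_i of the
    equation, under which a gain still counts at its own date. *)
Definition step_process (u : R) (f : Omega -> R) (t : R) (w : Omega) : R :=
  if u < t then f w else 0.

Let right_step c (f : Omega -> R) (t : R) w : R := if c <= t then f w else 0.

Let right_step_cadlag c f : cadlag (right_step c f).
Proof.
move=> w; split => t t0.
  apply: cvg_near_cst; rewrite /right_step; have [ct|tc] := leP c t.
    by near=> s; rewrite (le_trans ct)//; near: s; exact: nbhs_right_ge.
  by near=> s; rewrite ifF//; apply/negbTE; rewrite -ltNge; near: s; exact: nbhs_right_lt.
apply/cvg_ex; have [ct|tc] := ltP c t.
  exists (f w); apply: cvg_near_cst; near=> s; rewrite /right_step ifT//.
  by near: s; exact: nbhs_left_ge.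
exists 0; apply: cvg_near_cst; near=> s; rewrite /right_step ifF//.
by apply/negbTE; rewrite -ltNge (lt_le_trans _ tc)//; near: s; exact: nbhs_left_lt.
Unshelve. all: by end_near. Qed.

Lemma measurable_wrt_cst t (c : R) : 0 <= t -> measurable_wrt (F t) (cst c).
Proof. by move=> t0; apply/measurable_wrtP; [exact: sF|exact: measurable_cst]. Qed.

Let right_step_adapted u c f : 0 <= u -> u <= c -> measurable_wrt (F u) f ->
  adapted F (right_step c f).
Proof.
move=> u0 uc mf t t0; rewrite /right_step; case: leP => ct; last exact: measurable_wrt_cst.
by apply: measurable_wrt_sub mf; apply: FF => //; exact: le_trans ct.
Qed.

(** Not cadlag itself, the step is the pointwise limit of the cadlag steps that start at u +
    1/(n+1). *)
Lemma step_process_optional u f : 0 <= u -> measurable_wrt (F u) f ->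
  optional F (step_process u f).
Proof.
move=> u0 mf; apply/optionalP.
apply: (@measurable_fun_cvg _ (g_sigma_algebraType optional_sets) R setT
  (fun n z => right_step (u + n.+1%:R^-1) f z.1 z.2)).
  move=> n; have /optionalP : optional F (right_step (u + n.+1%:R^-1) f).
    apply: cadlag_optional => //.
    by apply: (right_step_adapted u0 _ mf); rewrite lerDl invr_ge0.
  exact.
move=> [t w] _ /=; rewrite /step_process /right_step; have [ut|tu] := ltP u t.
  apply: cvg_near_cst; exists (Num.truncn (t - u)^-1) => // n /= Nn.
  rewrite ifT// -lerBrDl invf_ple ?posrE ?subr_gt0//.
  by rewrite ltW// (lt_le_trans (truncnS_gt _))// ler_nat ltnS.
apply: cvg_near_cst; apply: nearW => n; rewrite ifF//; apply/negbTE.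
by rewrite -ltNge (le_lt_trans tu)// ltrDl invr_gt0.
Qed.

Lemma step_process_bounded_variation u f t w : bounded_variation 0 t (step_process u f ^~ w).
Proof.
have [f0|f0] := leP 0 (f w).
  apply: nondecreasing_bounded_variation => x y _ _ xy; rewrite /step_process.
  by case: (ltP u x) => ux; case: (ltP u y) => uy //; have := lt_le_trans ux xy; rewrite ltNge uy.
rewrite (_ : _ ^~ w = \- (step_process u (fun w => - f w) ^~ w)).
  apply: bounded_variationN.
  apply: nondecreasing_bounded_variation => x y _ _ xy; rewrite /step_process.
  case: (ltP u x) => ux; case: (ltP u y) => uy //; last by rewrite oppr_ge0 ltW.
  by have := lt_le_trans ux xy; rewrite ltNge uy.
by apply/funext => s; rewrite /step_process/=; case: ifP; rewrite ?opprK ?oppr0.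
Qed.

Lemma bounded_variation_sum (I : Type) (r : seq I) (f : I -> R -> R) a b :
  a <= b -> (forall i, bounded_variation a b (f i)) ->
  bounded_variation a b (fun s => \sum_(i <- r) f i s).
Proof.
rewrite le_eqVlt => /predU1P[-> _|ab bf]; first exact: bounded_variationxx.
elim: r => [|i r IH].
  rewrite (_ : (fun _ => _) = cst 0); last by apply/funext => s; rewrite big_nil.
  by apply: nondecreasing_bounded_variation.
rewrite (_ : (fun _ => _) = f i \+ (fun s => \sum_(j <- r) f j s)).
  exact: bounded_variationD.
by apply/funext => s; rewrite big_cons.
Qed.

End OptionalProcesses.

(** * Linearity and uniqueness of conditional expectations *)

Section ConditionalExpectationTheory.
Context {R : realType} {d : measure_display} {Omega : measurableType d}.
Variable Pr : probability Omega R.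
Variable G : set (set Omega).
Hypothesis sG : sigma_algebra setT G.
Hypothesis Gm : G `<=` measurable.
Implicit Types X Y : Omega -> R.

Lemma measurable_wrtB X Y : measurable_wrt G X -> measurable_wrt G Y ->
  measurable_wrt G (fun w => X w - Y w).
Proof.
move=> mX mY; apply/(measurable_wrtP _ sG); apply: measurable_funB.
  exact/(measurable_wrtP _ sG).
exact/(measurable_wrtP _ sG).
Qed.

Lemma measurable_wrtD X Y : measurable_wrt G X -> measurable_wrt G Y ->
  measurable_wrt G (fun w => X w + Y w).
Proof.
move=> mX mY; apply/(measurable_wrtP _ sG); apply: measurable_funD.
  exact/(measurable_wrtP _ sG).
exact/(measurable_wrtP _ sG).
Qed.

Lemma measurable_wrt_sum (I : finType) (P : pred I) (f : I -> Omega -> R) :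
  (forall i, P i -> measurable_wrt G (f i)) ->
  measurable_wrt G (fun w => \sum_(i | P i) f i w).
Proof.
move=> mf; apply/(measurable_wrtP _ sG).
rewrite (_ : (fun w => _) = (fun w => \sum_i (if P i then f i w else 0))).
  apply: measurable_sum => i; have [Pi|_] := boolP (P i); last exact: measurable_cst.
  by apply/(measurable_wrtP _ sG); exact: mf.
by apply/funext => w; rewrite big_mkcond.
Qed.

Lemma integrable_subset X A : G A -> Pr.-integrable setT (EFin \o X) ->
  Pr.-integrable A (EFin \o X).
Proof. by move=> GA; apply: integrableS => //; exact: Gm. Qed.

Lemma is_cond_expectationB X X' Y Y' :
  Pr.-integrable setT (EFin \o X) -> Pr.-integrable setT (EFin \o X') ->
  is_cond_expectation Pr G X Y -> is_cond_expectation Pr G X' Y' ->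
  is_cond_expectation Pr G (fun w => X w - X' w) (fun w => Y w - Y' w).
Proof.
move=> iX iX' [mY iY YE] [mY' iY' YE']; split.
- exact: measurable_wrtB.
- apply: (eq_integrable _ _ _ _ (integrableB _ iY iY')) => //.
- move=> A GA; have mA := Gm GA.
  under eq_integral do rewrite EFinB.
  under [RHS]eq_integral do rewrite EFinB.
  rewrite !integralB_EFin//; first by rewrite YE// YE'.
  + exact: integrable_subset iX.
  + exact: integrable_subset iX'.
  + exact: integrable_subset iY.
  + exact: integrable_subset iY'.
Qed.

Lemma is_cond_expectation_unique X Y Y' :
  is_cond_expectation Pr G X Y -> is_cond_expectation Pr G X Y' ->
  \forall w \ae Pr, Y w = Y' w.
Proof.
suff H Z Z' : is_cond_expectation Pr G X Z -> is_cond_expectation Pr G X Z' ->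
    \forall w \ae Pr, 0 <= Z w - Z' w.
  move=> cY cY'; apply: filterS2 (H _ _ cY cY') (H _ _ cY' cY) => w.
  by rewrite !subr_ge0 => h1 h2; apply/le_anti; rewrite h1 h2.
move=> [mZ iZ ZE] [mZ' iZ' ZE'].
apply: (@ge0_ae_of_integral _ _ _ Pr G) => //.
- exact: measurable_wrtB.
- by apply: (eq_integrable _ _ _ _ (integrableB _ iZ iZ')).
- move=> A GA; under eq_integral do rewrite EFinB.
  have iZA := integrable_subset GA iZ.
  rewrite integralB_EFin ?ZE ?ZE'//; last exact: integrable_subset iZ'.
    by rewrite subee// -ZE//; apply: integrable_fin_num => //; exact: Gm.
  exact: Gm.
Qed.

Lemma is_cond_expectation_ae X X' Y : measurable_fun setT X ->
  measurable_fun setT X' -> (\forall w \ae Pr, X w = X' w) ->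
  is_cond_expectation Pr G X Y -> is_cond_expectation Pr G X' Y.
Proof.
move=> mX mX' XX' [mY iY YE]; split => // A GA; rewrite YE//.
apply: ae_eq_integral; first exact: Gm.
- exact/measurable_funTS/measurable_EFinP.
- exact/measurable_funTS/measurable_EFinP.
- by apply: filterS XX' => w ->.
Qed.

Lemma is_cond_expectation_self X : measurable_wrt G X ->
  Pr.-integrable setT (EFin \o X) -> is_cond_expectation Pr G X X.
Proof. by []. Qed.

End ConditionalExpectationTheory.

(** * Cadlag martingales closed by an integrable variable *)

Section CadlagMartingales.
Context {R : realType} {d : measure_display} {Omega : measurableType d}.
Variable Pr : probability Omega R.
Variable F : R -> set (set Omega).
Hypothesis fF : filtration F.
Hypothesis uF : usual_conditions Pr F.

Let sF t : 0 <= t -> sigma_algebra setT (F t). Proof. by case: fF => + _ _; exact. Qed.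
Let Fm t : 0 <= t -> F t `<=` measurable. Proof. by case: fF => _ + _; exact. Qed.

Lemma ge0_cadlag_condexp_ex (xi : Omega -> R) : (forall w, 0 <= xi w) ->
  Pr.-integrable setT (EFin \o xi) ->
  exists Z : R -> Omega -> R, [/\ adapted F Z, cadlag Z, (forall t w, 0 <= Z t w) &
    forall t A, 0 <= t -> F t A ->
      (\int[Pr]_(w in A) (Z t w)%:E = \int[Pr]_(w in A) (xi w)%:E)%E].
Proof.
move=> xi0 ixi.
have mxi : measurable_fun setT xi by apply/measurable_EFinP; exact: measurable_int ixi.
have ex s : exists Y : Omega -> R, (forall w, 0 <= Y w) /\
    (0 <= s -> is_cond_expectation Pr (F s) xi Y).
  have [s0|s0] := leP 0 s; last by exists (cst 0); split.
  by have [Y YE Y0] := condexp_ge0_ex (sF s0) (Fm s0) ixi xi0; exists Y.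
pose Y s := sval (cid (ex s)).
have Y0 s w : 0 <= Y s w by rewrite /Y; case: cid => ? [].
have YE s : 0 <= s -> is_cond_expectation Pr (F s) xi (Y s).
  by rewrite /Y; case: cid => ? [].
have mY s : 0 <= s -> measurable_wrt (F s) (Y s) by move=> /YE[].
have YE' s A : 0 <= s -> F s A ->
    (\int[Pr]_(w in A) (Y s w)%:E = \int[Pr]_(w in A) (xi w)%:E)%E.
  by move=> /YE[_ _]; exact.
exists (cadlag_version Y); split.
- exact: (cadlag_version_adapted fF uF mxi xi0 ixi Y0 mY YE').
- exact: cadlag_version_cadlag.
- exact: cadlag_version_ge0.
- by move=> t A t0 FA; exact: (integral_cadlag_version fF uF mxi xi0 ixi Y0 mY YE').
Qed.

(** [Z] is the difference of the versions for [xi^\+] and [xi^\-], and their stopped values are [X1]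
    and [X2]. The excess bounds need a sign, so they are recorded for the two parts before the
    difference is taken. *)
Lemma cadlag_condexp_ex (xi : Omega -> R) : Pr.-integrable setT (EFin \o xi) ->
  exists Z : R -> Omega -> R, [/\ adapted F Z, cadlag Z,
    (forall t, 0 <= t -> is_cond_expectation Pr (F t) xi (Z t)) &
    forall tau : Omega -> R, stopping_time F (EFin \o tau) ->
      measurable_fun setT (fun w => Z (tau w) w) /\
      exists X1 X2 : Omega -> R,
        [/\ measurable_fun setT X1, measurable_fun setT X2,
            (forall w, `|Z (tau w) w| <= X1 w + X2 w),
            (forall m, 0 <= m -> (excess Pr X1 m <= excess Pr (xi^\+)%R m)%E) &
            (forall m, 0 <= m -> (excess Pr X2 m <= excess Pr (xi^\-)%R m)%E)]].
Proof.
move=> ixi.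
have mxi : measurable_fun setT xi by apply/measurable_EFinP; exact: measurable_int ixi.
have ip : Pr.-integrable setT (EFin \o xi^\+) by exact: integrable_funrpos.
have im : Pr.-integrable setT (EFin \o xi^\-) by exact: integrable_funrneg.
have mp : measurable_fun setT xi^\+ by exact: measurable_funrpos.
have mn : measurable_fun setT xi^\- by exact: measurable_funrneg.
have [Z1 [a1 c1 p1 E1]] := ge0_cadlag_condexp_ex (funrpos_ge0 xi) ip.
have [Z2 [a2 c2 p2 E2]] := ge0_cadlag_condexp_ex (funrneg_ge0 xi) im.
have condE (f : Omega -> R) (Z : R -> Omega -> R) t : (forall w, 0 <= f w) ->
    Pr.-integrable setT (EFin \o f) -> adapted F Z ->
    (forall t w, 0 <= Z t w) -> (forall t A, 0 <= t -> F t A ->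
      (\int[Pr]_(w in A) (Z t w)%:E = \int[Pr]_(w in A) (f w)%:E)%E) ->
    0 <= t -> is_cond_expectation Pr (F t) f (Z t).
  move=> f0 iF aZ pZ EZ t0; split; [exact: aZ| |by move=> A; exact: EZ].
  have mZ : measurable_fun setT (Z t) by exact: measurable_wrt_measurable (Fm t0) (aZ t t0).
  apply/integrableP; split; first exact/measurable_EFinP.
  have /integrableP[_] := iF.
  under eq_integral do rewrite /= ger0_norm//.
  move=> fy; under eq_integral do rewrite /= ger0_norm//.
  rewrite EZ//; last by case: (sF t0) => F0 FD _; rewrite -(setD0 setT); exact: FD.

exists (fun t w => Z1 t w - Z2 t w); split.
- by move=> t t0; apply: measurable_wrtB; [exact: sF|exact: a1|exact: a2].
- move=> w; have [r1 l1] := c1 w; have [r2 l2] := c2 w; split => t t0.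
    by apply: cvgB; [exact: r1|exact: r2].
  by apply: is_cvgB; [exact: l1|exact: l2].
- move=> t t0; rewrite (_ : xi = fun w => xi^\+ w - xi^\- w).
    apply: is_cond_expectationB => //; [exact: sF|exact: Fm| |].
      exact: condE.
    exact: condE.
  apply/funext => w; rewrite /funrpos /funrneg.
  by rewrite !maxr_absE !subr0 normrN; move: `|_| => a; lra.
- move=> tau stau.
  have m1 := measurable_stopped fF a1 c1 stau.
  have m2 := measurable_stopped fF a2 c2 stau.
  split; first exact: measurable_funB.
  exists (fun w => Z1 (tau w) w), (fun w => Z2 (tau w) w); split => //.
  + by move=> w; rewrite (le_trans (ler_normB _ _))// !ger0_norm.
  + by move=> m m0; exact: (excess_stopped fF mp (funrpos_ge0 xi) a1 c1 p1 E1 stau m0).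
  + by move=> m m0; exact: (excess_stopped fF mn (funrneg_ge0 xi) a2 c2 p2 E2 stau m0).
Qed.

End CadlagMartingales.

(** * Uniqueness *)

Section MartingaleDifference.
Context {R : realType} {d : measure_display} {Omega : measurableType d}.
Variable Pr : probability Omega R.
Variable F : R -> set (set Omega).
Hypothesis fF : filtration F.

Let sF t : 0 <= t -> sigma_algebra setT (F t). Proof. by case: fF => + _ _; exact. Qed.
Let Fm t : 0 <= t -> F t `<=` measurable. Proof. by case: fF => _ + _; exact. Qed.

Lemma ae_integrable (f g : Omega -> R) : measurable_fun setT g ->
  (\forall w \ae Pr, f w = g w) -> Pr.-integrable setT (EFin \o f) ->
  Pr.-integrable setT (EFin \o g).
Proof.
move=> mg fg iF; have /integrableP[mf fy] := iF.
apply/integrableP; split; first exact/measurable_EFinP.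
rewrite (_ : (\int[Pr]_x _)%E = (\int[Pr]_x `|(EFin \o f) x|)%E)//.
apply: ae_eq_integral => //.
- by apply: measurableT_comp => //; exact/measurable_EFinP.
- exact: measurableT_comp.
- by apply: filterS fg => w /= ->.
Qed.

(* A difference of values of a martingale at [s <= T] is orthogonal to [F s],
   hence vanishes as soon as it is [F s]-measurable. *)
Lemma martingale_increment_eq0 (M M' : R -> Omega -> R) (s T : R) (X : Omega -> R) :
  martingale Pr F M -> martingale Pr F M' -> 0 <= s -> s <= T ->
  measurable_wrt (F s) X ->
  (\forall w \ae Pr, X w = (M s w - M' s w) - (M T w - M' T w)) ->
  \forall w \ae Pr, X w = 0.
Proof.
move=> [aM _ iM cM] [aM' _ iM' cM'] s0 sT mX XE.
have T0 : 0 <= T := le_trans s0 sT.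
have cs := is_cond_expectationB (sF s0) (Fm s0) (iM T T0) (iM' T T0)
  (cM s T s0 sT) (cM' s T s0 sT).
have mK u : 0 <= u -> measurable_fun setT (fun w => M u w - M' u w).
  move=> u0; apply: (measurable_wrt_measurable (Fm u0)).
  by apply: measurable_wrtB; [exact: sF|exact: aM|exact: aM'].
have mY : measurable_wrt (F s) (fun w => M s w - M' s w - X w).
  apply: measurable_wrtB => //; first exact: sF.
  by apply: measurable_wrtB; [exact: sF|exact: aM|exact: aM'].
have mY' := measurable_wrt_measurable (Fm s0) mY.
have KY : \forall w \ae Pr, M T w - M' T w = M s w - M' s w - X w.
  by apply: filterS XE => w ->; rewrite subKr.
have iK : Pr.-integrable setT (EFin \o (fun w => M T w - M' T w)).
  exact: (eq_integrable _ _ _ _ (integrableB _ (iM T T0) (iM' T T0))).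
have iY := ae_integrable mY' KY iK.
(* This [F s]-measurable variable equals the difference at [T] almost surely, so it is a conditional
   expectation of it, as is the difference at [s]; comparing the two leaves X = 0. *)
have cY : is_cond_expectation Pr (F s) (fun w => M T w - M' T w)
    (fun w => M s w - M' s w - X w).
  apply: (@is_cond_expectation_ae _ _ _ Pr (F s) (Fm s0)
    (fun w => M s w - M' s w - X w)) => //; first exact: mK.
  by apply: filterS KY => w ->.
apply: filterS (is_cond_expectation_unique (sF s0) (Fm s0) cs cY) => w h.
by move: (X w) (M s w - M' s w) h => x k; lra.
Qed.

End MartingaleDifference.

Section Uniqueness.
Context {R : realType} {d : measure_display} {Omega : measurableType d}.
Variable Pr : probability Omega R.
Variable F : R -> set (set Omega).
Hypothesis fF : filtration F.
Variables (T : R) (N : nat) (t : 'I_N.+1 -> R) (Pay : R -> Omega -> R) (lambda : R).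
Hypothesis t0 : forall i, 0 <= t i.
Hypothesis tT : forall i, t i < T.
Hypothesis tmono : {homo t : i j / (i < j)%N >-> i < j}.

Let sF s : 0 <= s -> sigma_algebra setT (F s). Proof. by case: fF => + _ _; exact. Qed.
Let Fm s : 0 <= s -> F s `<=` measurable. Proof. by case: fF => _ + _; exact. Qed.

Let term (V : R -> Omega -> R) i w : R :=
  lambda * Phi ((Pay (t i) w - right_limit V (t i) w) / lambda).

Lemma tmono_lt i j : t i < t j -> (i < j)%N.
Proof.
apply: contraTltn => ji; rewrite -leNgt.
move: ji; rewrite leq_eqVlt => /predU1P[/val_inj -> //|/tmono/ltW//].
Qed.

(** Just after [t i] the set of dates still to come no longer changes, so [V] moves there like the
    cadlag [M]. Hence [right_limit], defined through [lim], is a genuine limit. *)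
Lemma solution_right_limit V M : cadlag M ->
  solves_backward_equation Pr T t Pay lambda V M ->
  \forall w \ae Pr, forall i, V s w @[s --> (t i)^'+] --> right_limit V (t i) w.
Proof.
move=> cM; apply: filterS => w eqV i.
have [/(_ _ (t0 i)) cMi _] := cM w.
suff [l Vl] : exists l : R, V s w @[s --> (t i)^'+] --> l.
  by rewrite /right_limit (cvg_lim _ Vl).
pose A := \sum_(j < N.+1 | t i < t j < T) term V j w.
exists (Pay T w - (M T w - M (t i) w) + A).
apply: cvg_trans (_ : (Pay T w - (M T w - M s w) + A) @[s --> (t i)^'+] --> _); last first.
  by apply: cvgD; [apply: cvgB; [exact: cvg_cst|apply: cvgB => //; exact: cvg_cst]|exact: cvg_cst].
have sE : \forall s \near (t i)^'+, forall j, (s <= t j) = (t i < t j).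
  apply: (@filter_forall _ _ (fun j s => (s <= t j) = (t i < t j))) => j.
  have [ij|ji] := ltP (t i) (t j).
    by apply: filterS (nbhs_right_lt ij) => s /ltW ->.
  apply: filterS (nbhs_right_gt (t i)) => s si; apply/negbTE.
  by rewrite -ltNge (le_lt_trans ji).
apply: near_eq_cvg; near=> s.
have sE' : forall j, (s <= t j) = (t i < t j) by near: s.
rewrite eqV.
  by congr (_ + _); apply: eq_bigl => j; rewrite sE'.
rewrite (le_trans (t0 i)) ?andTb; last by apply/ltW; near: s; exact: nbhs_right_gt.
by apply/ltW; near: s; exact: nbhs_right_lt.
Unshelve. all: by end_near. Qed.

Variables (V M V' M' : R -> Omega -> R).
Hypothesis aV : adapted F V.
Hypothesis aV' : adapted F V'.
Hypothesis mM : martingale Pr F M.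
Hypothesis mM' : martingale Pr F M'.
Hypothesis M0 : forall w, M 0 w = 0.
Hypothesis M'0 : forall w, M' 0 w = 0.
Hypothesis VM : solves_backward_equation Pr T t Pay lambda V M.
Hypothesis VM' : solves_backward_equation Pr T t Pay lambda V' M'.

Let eq_at s : 0 <= s <= T ->
  (\forall w \ae Pr, forall j, s <= t j ->
    right_limit V (t j) w = right_limit V' (t j) w) ->
  \forall w \ae Pr, V s w - V' s w = 0.
Proof.
move=> s0T rl; have /andP[s0 sT] := s0T.
apply: (martingale_increment_eq0 fF mM mM' s0 sT).
  by apply: measurable_wrtB; [exact: sF|exact: aV|exact: aV'].
apply: filterS3 rl VM VM' => w rw -> // -> //.
rewrite (eq_bigr (fun j => lambda * Phi ((Pay (t j) w - right_limit V' (t j) w) / lambda))).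
  by move: (\sum_(j < _ | _) _) => a; lra.
by move=> j /andP[sj _]; rewrite rw.
Qed.

Lemma solution_right_limit_eq :
  \forall w \ae Pr, forall j, right_limit V (t j) w = right_limit V' (t j) w.
Proof.
have [cM cM'] : cadlag M /\ cadlag M' by case: mM mM' => _ ? _ _ [].
apply: filter_forall => i.
have [n] := ubnP (N.+1 - i); elim: n i => // n IH i; rewrite ltnS => iN.
have later : \forall w \ae Pr, forall j, t i < t j ->
    right_limit V (t j) w = right_limit V' (t j) w.
  apply: filter_forall => j; have [ij|_] := boolP (t i < t j); last exact: nearW.
  have {}ij := tmono_lt ij.
  have := IH j (leq_trans (ltn_sub2l (ltn_ord i) ij) iN).
  by apply: filterS.
(* Any sequence in (t i, T] tending to [t i] would do, even beyond later dates: s m <= t j forces t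
   i < t j. Working along a sequence keeps the exceptional sets countable in number. *)
pose s n := t i + (T - t i) * harmonic n : R.
have Ti : 0 < T - t i by rewrite subr_gt0.
have h0 m : 0 < harmonic m :> R by rewrite invr_gt0.
have s_gt m : t i < s m by rewrite ltrDl mulr_gt0.
have s_le m : 0 <= s m <= T.
  rewrite (le_trans (t0 i)) ?(ltW (s_gt m))//= /s -lerBrDl ler_piMr ?(ltW Ti)//.
  by rewrite invf_le1// ler1n.
have s_cvg : s m @[m --> \oo] --> t i.
  rewrite -[X in _ --> X]addr0 -[X in _ + X](mulr0 (T - t i)).
  by apply: cvgD; [exact: cvg_cst|apply: cvgMl_tmp; exact: cvg_harmonic].
have eq_s : \forall w \ae Pr, forall m, V (s m) w - V' (s m) w = 0.
  apply: ae_foralln => m; apply: eq_at => //.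
  by apply: filterS later => w H j sj; apply: H; exact: lt_le_trans sj.
apply: filterS3 eq_s (solution_right_limit cM VM) (solution_right_limit cM' VM').
move=> w eq_s /(_ i)/cvg_at_rightP/(_ s (conj s_gt s_cvg)) c1.
move=> /(_ i)/cvg_at_rightP/(_ s (conj s_gt s_cvg)) c2.
apply: (cvg_unique _ c1) => //.
rewrite (_ : (fun m => V (s m) w) = (fun m => V' (s m) w))//.
by apply/funext => m; apply/eqP; rewrite -subr_eq0; apply/eqP.
Qed.

Lemma solution_unique :
  indistinguishable_on Pr `[0, T] V V' /\ indistinguishable_on Pr `[0, T] M M'.
Proof.
have [aM cM iM ceM] := mM; have [aM' cM' iM' ceM'] := mM'.
have T0 : 0 <= T by rewrite (le_trans (t0 ord0))// ltW.
have rl := solution_right_limit_eq.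
(* At time 0 both martingales vanish, so the equation turns the agreement of [V] and [V'] into that
   of [M T] and [M' T], and the terminal values determine both martingales on [0, T]. *)
have V0 : \forall w \ae Pr, V 0 w - V' 0 w = 0.
  by apply: eq_at; [rewrite lexx|apply: filterS rl => w H j _].
have termE w s : (forall j, right_limit V (t j) w = right_limit V' (t j) w) ->
    \sum_(i < N.+1 | s <= t i < T) term V i w = \sum_(i < N.+1 | s <= t i < T) term V' i w.
  by move=> rw; apply: eq_bigr => j _; rewrite /term rw.
have MT : \forall w \ae Pr, M T w = M' T w.
  apply: filterS2 (filterI VM VM') (filterI rl V0) => w [eV eV'] [rw].
  rewrite eV ?lexx// eV' ?lexx// M0 M'0 (termE _ _ rw).
  by move: (\sum_(j < _ | _) _) => a; lra.
have mMT : measurable_fun setT (M T) by exact: measurable_wrt_measurable (Fm T0) (aM T T0).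
have mMT' : measurable_fun setT (M' T) by exact: measurable_wrt_measurable (Fm T0) (aM' T T0).
have Ms s : 0 <= s -> s <= T -> \forall w \ae Pr, M s w = M' s w.
  move=> s0 sT; apply: (is_cond_expectation_unique (sF s0) (Fm s0) _ (ceM' s T s0 sT)).
  exact: (is_cond_expectation_ae (Fm s0) mMT mMT' MT (ceM s T s0 sT)).
have Mgrid : \forall w \ae Pr, forall n k : nat, grid n k <= T -> M (grid n k) w = M' (grid n k) w.
  apply: ae_foralln => n; apply: ae_foralln => k.
  have [kT|_] := boolP (grid n k <= T); last exact: nearW.
  by apply: filterS (Ms _ (grid_ge0 n k) kT).
have Meq : \forall w \ae Pr, forall s, 0 <= s <= T -> M s w = M' s w.
  apply: filterS2 Mgrid MT => w Mg MTw s /andP[s0].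
  (* [T] is treated apart, since grid points to its right would leave [0, T]. *)
  rewrite le_eqVlt => /predU1P[-> //|sT].
  have [/(_ s s0)/cvg_at_rightP c _] := cM w.
  have [/(_ s s0)/cvg_at_rightP c' _] := cM' w.
  pose q n : R := grid n (next_index n s).
  have qs n : s < q n by exact: next_index_gt.
  have near_q e : 0 < e -> exists K, forall n, (K <= n)%N -> q n <= s + e.
    move=> /invexpr2_lt[K Ke]; exists K => n Kn.
    rewrite (le_trans (next_index_le n s0))// lerD2l (le_trans _ (ltW Ke))//.
    by rewrite lef_pV2 ?posrE ?exprn_gt0// ler_eXn2l// ltr1n.
  have q_cvg : q n @[n --> \oo] --> s.
    apply/cvgrPdist_le => e /near_q[K Ke]; exists K => // n /= Kn.
    by rewrite distrC ger0_norm; [rewrite lerBlDl Ke|rewrite subr_ge0 ltW].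
  have [K KT] := near_q (T - s) ltac:(by rewrite subr_gt0).
  apply: (cvg_unique _ (c q (conj qs q_cvg))) => //.
  apply: cvg_trans (c' q (conj qs q_cvg)); apply: near_eq_cvg.
  exists K => // n /= Kn; rewrite Mg//; have := KT n Kn; by rewrite addrC subrK.
split; last by apply: filterS Meq => w H s; rewrite /= in_itv/=; exact: H.
apply: filterS2 (filterI VM VM') (filterI rl Meq) => w [eV eV'] [rw Mw] s.
rewrite /= in_itv/= => s0T.
by rewrite eV// eV'// (Mw s s0T) (Mw T) ?T0 ?lexx//; congr (_ + _); exact: termE.
Qed.

End Uniqueness.

(** * Existence *)

Section IntegrableRealFunctions.
Context {R : realType} {d : measure_display} {Omega : measurableType d}.
Variable Pr : probability Omega R.

Lemma integrable_sum_EFin (I : finType) (P : pred I) (f : I -> Omega -> R) :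
  (forall i, P i -> Pr.-integrable setT (EFin \o f i)) ->
  Pr.-integrable setT (EFin \o (fun w => \sum_(i | P i) f i w)).
Proof.
move=> iF; rewrite (_ : _ \o _ = fun w => (\sum_(i | P i) (f i w)%:E)%E).
  exact: (@integrable_sum _ _ _ _ _ measurableT _ _ P (fun i w => (f i w)%:E)).
by apply/funext => w /=; rewrite sumEFin.
Qed.

Lemma integrableD_EFin (f g : Omega -> R) : Pr.-integrable setT (EFin \o f) ->
  Pr.-integrable setT (EFin \o g) ->
  Pr.-integrable setT (EFin \o (fun w => f w + g w)).
Proof.
by move=> iF ig; apply: (eq_integrable _ _ _ _ (integrableD _ iF ig)).
Qed.

Lemma integrableB_EFin (f g : Omega -> R) : Pr.-integrable setT (EFin \o f) ->
  Pr.-integrable setT (EFin \o g) ->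
  Pr.-integrable setT (EFin \o (fun w => f w - g w)).
Proof.
by move=> iF ig; apply: (eq_integrable _ _ _ _ (integrableB _ iF ig)).
Qed.

End IntegrableRealFunctions.

Section Existence.
Context {R : realType} {d : measure_display} {Omega : measurableType d}.
Variable Pr : probability Omega R.
Variable F : R -> set (set Omega).
Hypothesis fF : filtration F.
Variables (T : R) (N : nat) (t : 'I_N.+1 -> R) (Pay : R -> Omega -> R) (lambda : R).
Hypothesis t0 : forall i, 0 <= t i.
Hypothesis aPay : adapted F Pay.
Hypothesis lambda0 : 0 < lambda.
Hypothesis iPayt : forall i, Pr.-integrable setT (EFin \o Pay (t i)).
Hypothesis iPayT : Pr.-integrable setT (EFin \o Pay T).

Let sF s : 0 <= s -> sigma_algebra setT (F s). Proof. by case: fF => + _ _; exact. Qed.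
Let Fm s : 0 <= s -> F s `<=` measurable. Proof. by case: fF => _ + _; exact. Qed.

Definition smoothed_gain (i : 'I_N.+1) (y : Omega -> R) (w : Omega) : R :=
  lambda * Phi ((Pay (t i) w - y w) / lambda).

Lemma measurable_wrt_smoothed_gain i y : measurable_wrt (F (t i)) y ->
  measurable_wrt (F (t i)) (smoothed_gain i y).
Proof.
move=> my; apply/measurable_wrtP; first exact: sF.
apply: measurable_funM => //; apply: (measurableT_comp measurable_Phi).
apply: measurable_funM => //.
by apply/(measurable_wrtP _ (sF (t0 i))); apply: (measurable_wrtB (sF (t0 i))) => //; exact: aPay.
Qed.

(** The factor [lambda] outside [Phi] cancels the division inside, so the bound is free of
    [lambda]. *)
Lemma smoothed_gain_le i y w : `|smoothed_gain i y w| <= `|Pay (t i) w - y w|.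
Proof.
rewrite /smoothed_gain normrM (le_trans (ler_wpM2l _ (normr_Phi_le _)))//.
by rewrite -normrM mulrC divfK// gt_eqF.
Qed.

Lemma integrable_smoothed_gain i y : measurable_wrt (F (t i)) y ->
  Pr.-integrable setT (EFin \o y) -> Pr.-integrable setT (EFin \o smoothed_gain i y).
Proof.
move=> my iy.
have iB := integrableB (@measurableT _ Omega) (iPayt i) iy.
apply: (@le_integrable _ _ _ Pr setT measurableT (EFin \o smoothed_gain i y) _ _ _ iB).
  apply/measurable_EFinP; apply: (measurable_wrt_measurable (Fm (t0 i))).
  exact: measurable_wrt_smoothed_gain.
by move=> w _; rewrite lee_fin smoothed_gain_le.
Qed.

(* [Y i] will be [V_{t_i+}], the value of continuing just after [t_i]. *)
Lemma continuation_values_ex : exists Y : 'I_N.+1 -> Omega -> R, forall i,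
  is_cond_expectation Pr (F (t i))
    (fun w => Pay T w + \sum_(j < N.+1 | (i < j)%N) smoothed_gain j (Y j) w) (Y i).
Proof.
suff H n : exists Y : 'I_N.+1 -> Omega -> R, forall i : 'I_N.+1, (N - i < n)%N ->
    is_cond_expectation Pr (F (t i))
      (fun w => Pay T w + \sum_(j < N.+1 | (i < j)%N) smoothed_gain j (Y j) w) (Y i).
  have [Y YE] := H N.+1; exists Y => i; apply: YE.
  by rewrite ltnS leq_subr.
elim: n => [|n [Y YE]]; first by exists (fun _ _ => 0).
pose X i w := Pay T w + \sum_(j < N.+1 | (i < j)%N) smoothed_gain j (Y j) w.
have ex (i : 'I_N.+1) : exists y, (N - i <= n)%N -> is_cond_expectation Pr (F (t i)) (X i) y.
  have [iN|iN] := boolP (N - i <= n)%N; last by exists (cst 0).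
  have iX : Pr.-integrable setT (EFin \o X i).
    apply: integrableD_EFin => //; apply: integrable_sum_EFin => j ij.
    have [|my iy _] := YE j; last exact: integrable_smoothed_gain.
    by rewrite (leq_trans _ iN)// ltn_sub2l// (leq_trans ij)// -ltnS.
  by have [y yE] := condexp_ex (sF (t0 i)) (Fm (t0 i)) iX; exists y.
(* Induction on the number [n] of dates treated, counted from the last: values already built are
   kept, so the sums over later dates are unchanged, and only the date with N - i = n gets a new
   value that matters. *)
pose Y' (i : 'I_N.+1) := if (N - i < n)%N then Y i else sval (cid (ex i)).
exists Y' => i; rewrite ltnS => iN.
have XE : (fun w => Pay T w + \sum_(j < N.+1 | (i < j)%N) smoothed_gain j (Y' j) w) = X i.
  apply/funext => w; congr (_ + _); apply: eq_bigr => j ij.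
  by rewrite /Y' ifT// (leq_trans _ iN)// ltn_sub2l// (leq_trans ij)// -ltnS.
rewrite XE /Y'; case: ifPn => [|_]; first exact: YE.
by case: cid => y /=; exact.
Qed.

End Existence.

Section Solution.
Context {R : realType} {d : measure_display} {Omega : measurableType d}.
Variable Pr : probability Omega R.
Variable F : R -> set (set Omega).
Hypothesis fF : filtration F.
Variables (T : R) (N : nat) (t : 'I_N.+1 -> R) (Pay : R -> Omega -> R) (lambda : R).
Hypothesis t0 : forall i, 0 <= t i.
Hypothesis tT : forall i, t i < T.
Hypothesis tmono : {homo t : i j / (i < j)%N >-> i < j}.
Hypothesis aPay : adapted F Pay.
Hypothesis lambda0 : 0 < lambda.
Hypothesis iPayt : forall i, Pr.-integrable setT (EFin \o Pay (t i)).
Hypothesis iPayT : Pr.-integrable setT (EFin \o Pay T).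

Let sF s : 0 <= s -> sigma_algebra setT (F s). Proof. by case: fF => + _ _; exact. Qed.
Let Fm s : 0 <= s -> F s `<=` measurable. Proof. by case: fF => _ + _; exact. Qed.
Let FF r s : 0 <= r -> r <= s -> F r `<=` F s. Proof. by case: fF => _ _; exact. Qed.
Let T0 : 0 <= T. Proof. by rewrite (le_trans (t0 ord0))// ltW. Qed.

Variable Y : 'I_N.+1 -> Omega -> R.
Let g i := smoothed_gain t Pay lambda i (Y i).
Hypothesis YE : forall i, is_cond_expectation Pr (F (t i))
  (fun w => Pay T w + \sum_(j < N.+1 | (i < j)%N) g j w) (Y i).

Let xi w := Pay T w + \sum_i g i w.
Variable Z : R -> Omega -> R.
Hypothesis aZ : adapted F Z.
Hypothesis cZ : cadlag Z.
Hypothesis ZE : forall s, 0 <= s -> is_cond_expectation Pr (F s) xi (Z s).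
Hypothesis stopZ : forall tau : Omega -> R, stopping_time F (EFin \o tau) ->
  measurable_fun setT (fun w => Z (tau w) w) /\
  exists X1 X2 : Omega -> R,
    [/\ measurable_fun setT X1, measurable_fun setT X2,
        (forall w, `|Z (tau w) w| <= X1 w + X2 w),
        (forall m, 0 <= m -> (excess Pr X1 m <= excess Pr (xi^\+)%R m)%E) &
        (forall m, 0 <= m -> (excess Pr X2 m <= excess Pr (xi^\-)%R m)%E)].

Let mg i : measurable_wrt (F (t i)) (g i).
Proof. by have [mY _ _] := YE i; exact: (measurable_wrt_smoothed_gain fF lambda t0 aPay mY). Qed.

Let ig i : Pr.-integrable setT (EFin \o g i).
Proof.
have [mY iY _] := YE i.
exact: (integrable_smoothed_gain fF t0 aPay lambda0 iPayt mY iY).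
Qed.

Let mgT i : measurable_fun setT (g i).
Proof. exact: measurable_wrt_measurable (Fm (t0 i)) (mg i). Qed.

Let mg_later s i : t i <= s -> measurable_wrt (F s) (g i).
Proof. by move=> ts; apply: measurable_wrt_sub (mg i); exact: FF. Qed.

Let ixi : Pr.-integrable setT (EFin \o xi).
Proof. by apply: integrableD_EFin => //; exact: integrable_sum_EFin. Qed.

Let iZ s : 0 <= s -> Pr.-integrable setT (EFin \o Z s).
Proof. by move=> /ZE[]. Qed.

Definition solution_martingale (s : R) (w : Omega) : R := Z s w - Z 0 w.
(** [xi] contains the gains of all dates; this process takes back those already past. Writing it
    with step processes gives optionality and bounded variation term by term. *)
Definition exercise_gains (s : R) (w : Omega) : R :=
  \sum_i - step_process (t i) (g i) s w.
Definition solution_value (s : R) (w : Omega) : R := Z s w + exercise_gains s w.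

Local Notation M := solution_martingale.
Local Notation A := exercise_gains.
Local Notation V := solution_value.

Lemma exercise_gainsE s w : A s w = - \sum_(i | t i < s) g i w.
Proof.
by rewrite /exercise_gains sumrN [in RHS]big_mkcond.
Qed.

Lemma solution_martingale_martingale : martingale Pr F M.
Proof.
have aZ0 s : 0 <= s -> measurable_wrt (F s) (Z 0).
  by move=> s0; apply: measurable_wrt_sub (aZ (lexx 0)); exact: FF.
split.
- by move=> s s0; apply: measurable_wrtB; [exact: sF|exact: aZ|exact: aZ0].
- move=> w; have [r l] := cZ w; split => s s0.
    by apply: cvgB; [exact: r|exact: cvg_cst].
  by apply: is_cvgB; [exact: l|exact: is_cvg_cst].
- by move=> s s0; apply: integrableB_EFin; exact: iZ.
- move=> r s r0 rs; have s0 := le_trans r0 rs.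
  apply: (is_cond_expectationB (sF r0) (Fm r0)); [exact: iZ|exact: iZ| |].
    split; [exact: aZ|exact: iZ|move=> B FB].
    have [_ _ ->//] := ZE r0; have [_ _ ->//] := ZE s0.
    exact: FF FB.
  by apply: is_cond_expectation_self; [exact: aZ0|exact: iZ].
Qed.

Let stopping_cst s : 0 <= s -> stopping_time F (EFin \o (cst s : Omega -> R)).
Proof.
move=> s0; split => [w|r r0]; first by rewrite /= lee_fin.
have [F0 FC _] := sF r0; have [sr|rs] := leP s r.
  rewrite (_ : mkset _ = setT); first by rewrite -(setD0 setT); exact: FC.
  by apply/seteqP; split => w //=; rewrite lee_fin.
rewrite (_ : mkset _ = set0)//; apply/seteqP; split => w //=.
by rewrite lee_fin leNgt rs.
Qed.

(** Constant times are stopping times, so the bounds on stopped values of [Z] also cover the family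
    of all [M s]. *)
Lemma solution_martingale_ui : ui_martingale Pr F M.
Proof.
split; [exact: solution_martingale_martingale| |by move=> w; rewrite /solution_martingale subrr].
have mxi : measurable_fun setT xi by apply/measurable_EFinP; exact: measurable_int ixi.
have mZ s : 0 <= s -> measurable_fun setT (Z s).
  by move=> s0; exact: measurable_wrt_measurable (Fm s0) (aZ s0).
apply: (@uniformly_integrable_excess3 _ _ _ _ _ (xi^\+)%R (xi^\-)%R (fun w => `|Z 0 w|)).
  move=> f; rewrite !inE => /or3P[] /eqP ->; split.
  - exact: measurable_funrpos.
  - exact: funrpos_ge0.
  - exact: integrable_funrpos.
  - exact: measurable_funrneg.
  - exact: funrneg_ge0.
  - exact: integrable_funrneg.
  - by apply: measurableT_comp => //; exact: mZ.
  - by move=> w.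
  - by apply: integrable_norm; exact: iZ.
move=> _ [s /= s0 <-]; split; first by apply: measurable_funB; exact: mZ.
have [_ [X1 [X2 [m1 m2 ZX e1 e2]]]] := stopZ (stopping_cst s0).
exists X1, X2, (fun w => `|Z 0 w|); split.
- by split => //; apply: measurableT_comp => //; exact: mZ.
- by move=> w; rewrite (le_trans (ler_normB _ _))// lerD2r; exact: ZX.
- by move=> m m0; split; [exact: e1|exact: e2|].
Qed.

Lemma exercise_gains_optional : optional F A.
Proof.
by apply: optional_sum => i; apply: optionalN; exact: step_process_optional.
Qed.

Lemma solution_value_semimartingale : optional_semimartingale Pr F V.
Proof.
have [mM _ M0] := solution_martingale_ui; have [aM cM _ _] := mM.
split.
  by apply: optionalD; [exact: cadlag_optional|exact: exercise_gains_optional].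
exists M, A; split.
(* [M] is already a martingale, so the constant sequence +oo localizes it. *)
- split => //; exists (fun _ _ => +oo%E); split.
  + move=> n; split => [w|s s0]; first by rewrite leey.
    rewrite (_ : mkset _ = set0); first by case: (sF s0).
    by apply/seteqP; split.
  + by move=> w m n _.
  + by apply: aeW => w; exact: cvg_cst.
  + move=> n; rewrite (_ : stopped M _ = M)//.
    by apply/funext => s; apply/funext => w; rewrite /stopped miney.
- exact: exercise_gains_optional.
- move=> w s s0; apply: bounded_variation_sum => // i.
  by apply: bounded_variationN; exact: step_process_bounded_variation.
- move=> w; rewrite exercise_gainsE big1 ?oppr0// => i.
  by rewrite ltNge t0.
- move=> s w s0; rewrite /solution_value /solution_martingale.
  rewrite [A 0 w]exercise_gainsE big1; last first.
    by move=> i; rewrite ltNge t0.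
  by rewrite subr0 [Z 0 w + _]addrC subrK.
Qed.

(** At any stopping time the gains taken back are at most [G] in absolute value, an integrable bound
    that does not depend on tau. *)
Lemma solution_value_class_D : class_D Pr F V.
Proof.
have mxi : measurable_fun setT xi by apply/measurable_EFinP; exact: measurable_int ixi.
pose G w := \sum_i `|g i w|.
have mG : measurable_fun setT G by apply: measurable_sum => i; exact: measurableT_comp.
apply: (@uniformly_integrable_excess3 _ _ _ _ _ (xi^\+)%R (xi^\-)%R G).
  move=> f; rewrite !inE => /or3P[] /eqP ->; split => //.
  - exact: measurable_funrpos.
  - exact: integrable_funrpos.
  - exact: measurable_funrneg.
  - exact: integrable_funrneg.
  - by move=> w; apply: sumr_ge0.
  - by apply: integrable_sum_EFin => i _; exact: integrable_norm.
move=> _ [tau /= stau <-].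
have [mZt [X1 [X2 [m1 m2 ZX e1 e2]]]] := stopZ stau.
split.
  apply: measurable_funD => //; apply: measurable_sum => i.
  apply: measurable_funN; apply: measurable_fun_ifT => //.
  apply: (measurable_fun_bool true); rewrite setTI.
  rewrite (_ : _ @^-1` _ = ~` [set w | ((tau w)%:E <= (t i)%:E)%E]).
    apply: measurableC; apply: (Fm (t0 i)).
    by case: stau => _; apply.
  by apply/seteqP; split => w /=; rewrite lee_fin ltNge => /negP.
exists X1, X2, G; split => //.
- move=> w; rewrite (le_trans (ler_normD _ _))//; apply: lerD; first exact: ZX.
  rewrite (le_trans (ler_norm_sum _ _ _))//; apply: ler_sum => i _.
  by rewrite normrN /step_process; case: ifP; rewrite ?normr0.
- by move=> m m0; split; [exact: e1|exact: e2|].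
Qed.

Lemma solution_value_right_limit i w :
  right_limit V (t i) w = Z (t i) w - \sum_(j < N.+1 | (j <= i)%N) g j w.
Proof.
have leE (j : 'I_N.+1) : (j <= i)%N = (t j <= t i).
  apply/idP/idP => [|]; first by rewrite leq_eqVlt => /predU1P[/val_inj -> //|/tmono/ltW].
  by apply: contraTT; rewrite -ltnNge -ltNge; exact: tmono.
have [/(_ _ (t0 i)) Zi _] := cZ w.
suff Vi : V s w @[s --> (t i)^'+] --> Z (t i) w - \sum_(j < N.+1 | (j <= i)%N) g j w.
  exact: cvg_lim Vi.
apply: cvgD => //; apply: cvg_near_cst.
have sE : \forall s \near (t i)^'+, forall j, (t j < s) = (t j <= t i).
  apply: (@filter_forall _ _ (fun j s => (t j < s) = (t j <= t i))) => j.
  have [ji|ij] := leP (t j) (t i).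
    by apply: filterS (nbhs_right_gt (t i)) => s; exact: le_lt_trans.
  by apply: filterS (nbhs_right_lt ij) => s /ltW sj; apply/negbTE; rewrite -leNgt.
apply: filterS sE => s sE; rewrite exercise_gainsE; congr (- _).
by apply: eq_bigl => j; rewrite sE leE.
Qed.

(** Just after [t i] the gains [L] of the dates up to [i] are gone. They are [F (t i)]-measurable,
    and xi - L is the variable that [Y i] is the conditional expectation of. So the [g i], built
    from [Y i], are indeed the terms of the equation. *)
Lemma solution_continuation_value : \forall w \ae Pr, forall i,
  right_limit V (t i) w = Y i w.
Proof.
apply: filter_forall => i.
pose L w := \sum_(j < N.+1 | (j <= i)%N) g j w.
have mL : measurable_wrt (F (t i)) L.
  apply: (measurable_wrt_sum (sF (t0 i))) => j ji; apply: mg_later.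
  by move: ji; rewrite leq_eqVlt => /predU1P[/val_inj -> //|/tmono/ltW].
have iL : Pr.-integrable setT (EFin \o L) by exact: integrable_sum_EFin.
have cL : is_cond_expectation Pr (F (t i)) L L by exact: is_cond_expectation_self.
have := is_cond_expectationB (sF (t0 i)) (Fm (t0 i)) ixi iL (ZE (t0 i)) cL.
rewrite (_ : (fun w => xi w - L w) =
    (fun w => Pay T w + \sum_(j < N.+1 | (i < j)%N) g j w)); last first.
  apply/funext => w; rewrite /xi /L (bigID (fun j : 'I_N.+1 => (j <= i)%N))/=.
  rewrite -addrA addrAC subrr add0r; congr (_ + _).
  by apply: eq_bigl => j; rewrite ltnNge.
move=> cY; apply: filterS (is_cond_expectation_unique (sF (t0 i)) (Fm (t0 i)) cY (YE i)).
by move=> w <-; rewrite solution_value_right_limit.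
Qed.

(** [xi] is [F T]-measurable, so it equals [Z T] almost surely. Removing the gains of dates before
    [s] from it leaves the terminal payoff and exactly the sum in the equation. *)
Lemma solution_solves : solves_backward_equation Pr T t Pay lambda V M.
Proof.
have mxi : measurable_wrt (F T) xi.
  apply: (measurable_wrtD (sF T0)); first exact: aPay.
  by apply: (measurable_wrt_sum (sF T0)) => i _; apply: mg_later; exact: ltW.
have ZT : \forall w \ae Pr, Z T w = xi w.
  apply: (is_cond_expectation_unique (sF T0) (Fm T0) (ZE T0)).
  exact: is_cond_expectation_self.
apply: filterS2 ZT solution_continuation_value => w ZTw rl s /andP[s0 sT].
rewrite /solution_value exercise_gainsE /solution_martingale ZTw /xi.
rewrite [X in _ = _ + X](eq_bigr (fun i => g i w)); last by move=> i _; rewrite rl.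
have -> : \sum_i g i w = \sum_(i | t i < s) g i w + \sum_(i < N.+1 | s <= t i < T) g i w.
  rewrite (bigID (fun i => t i < s))/=; congr (_ + _).
  by apply: eq_bigl => i; rewrite -leNgt tT andbT.
move: (\sum_(i | _) _) (\sum_(i < N.+1 | _) _) => a b; lra.
Qed.

End Solution.

Theorem proposition3p1 (R : realType) (d : measure_display)
    (Omega : measurableType d) (Pr : probability Omega R)
    (F : R -> set (set Omega)) (T : R) (N : nat) (t : 'I_N.+1 -> R)
    (Pay : R -> Omega -> R) (lambda : R) :
  filtration F -> usual_conditions Pr F ->
  0 < T ->
  t ord0 = 0 -> {homo t : i j / (i < j)%N >-> i < j} -> t ord_max < T ->
  adapted F Pay -> (forall (s : R) (w : Omega), 0 <= s -> 0 <= Pay s w) ->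
  0 < lambda ->
  (maxe (\big[maxe/-oo]_(i < N.+1) 'E_Pr[Pay (t i)]) 'E_Pr[Pay T] < +oo)%E ->
  exists V M : R -> Omega -> R,
    [/\ semimartingale_D Pr F V, ui_martingale Pr F M,
        solves_backward_equation Pr T t Pay lambda V M &
        forall V' M' : R -> Omega -> R,
          semimartingale_D Pr F V' -> ui_martingale Pr F M' ->
          solves_backward_equation Pr T t Pay lambda V' M' ->
          indistinguishable_on Pr `[0, T] V' V /\
          indistinguishable_on Pr `[0, T] M' M].
Proof.
move=> fF uF T0 t00 tmono tmaxT aPay Pay0 lambda0 Efin.
have t0 i : 0 <= t i.
  have [->|i0] := eqVneq i ord0; first by rewrite t00.
  by rewrite -t00 ltW// tmono// lt0n; apply: contra_neq i0 => i0; exact: val_inj.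
have tT i : t i < T.
  apply: le_lt_trans tmaxT; have [->//|im] := eqVneq i ord_max.
  rewrite ltW// tmono// ltn_neqAle -ltnS ltn_ord andbT.
  by apply: contra_neq im => im; exact: val_inj.
(* A finite mean amounts to integrability because the payoff is non-negative. *)
have iPay s : 0 <= s -> ('E_Pr[Pay s] < +oo)%E -> Pr.-integrable setT (EFin \o Pay s).
  move=> s0; rewrite unlock => Ey; apply/integrableP; split.
    apply/measurable_EFinP; case: fF => _ Fm _.
    exact: measurable_wrt_measurable (Fm s s0) (aPay s s0).
  by under eq_integral do rewrite /= ger0_norm ?Pay0//.
move: Efin; rewrite gt_max => /andP[Eti ET].
have iPayt i : Pr.-integrable setT (EFin \o Pay (t i)).
  by apply: iPay => //; apply: le_lt_trans Eti; exact: le_bigmax.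
have iPayT := iPay T (ltW T0) ET.
have [Y YE] := continuation_values_ex fF t0 aPay lambda0 iPayt iPayT.
pose xi w := Pay T w + \sum_i smoothed_gain t Pay lambda i (Y i) w.
have ixi : Pr.-integrable setT (EFin \o xi).
  apply: integrableD_EFin => //; apply: integrable_sum_EFin => i _.
  have [mY iY _] := YE i.
  exact: (integrable_smoothed_gain fF t0 aPay lambda0 iPayt mY iY).
have [Z [aZ cZ ZE stopZ]] := cadlag_condexp_ex fF uF ixi.
pose V := solution_value t Pay lambda Y Z; pose M := solution_martingale Z.
have uiM : ui_martingale Pr F M.
  exact: (solution_martingale_ui fF t0 aPay lambda0 iPayt iPayT YE aZ cZ ZE stopZ).
have solVM : solves_backward_equation Pr T t Pay lambda V M.
  exact: (solution_solves fF t0 tT tmono aPay lambda0 iPayt iPayT YE cZ ZE).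
have dV : semimartingale_D Pr F V.
  split.
    exact: (solution_value_semimartingale fF t0 aPay lambda0 iPayt iPayT YE aZ cZ ZE stopZ).
  exact: (solution_value_class_D fF t0 aPay lambda0 iPayt iPayT YE stopZ).
exists V, M; split => // V' M' [[oV' _] _] [mM' _ M0'] sol'.
have [[oV _] _] := dV; have [mM _ M0] := uiM.
exact: (solution_unique fF t0 tT tmono (optional_adapted fF oV')
  (optional_adapted fF oV) mM' mM M0' M0 sol' solVM).
Qed.
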